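(* (a) For every planar graph $G$ it holds that $\chi_{\mathrm{so}}(G)\leq \chi_{\mathrm{pfo}}(\mathcal{P})\cdot\chi(G)$. (b) For every outerplanar graph $G$ it holds that $\chi_{\mathrm{so}}(G)\leq \chi_{\mathrm{pfo}}(\mathcal{P}_o)\cdot\chi(G)$.
   Context: A strong odd coloring of a simple graph $G$ is a proper vertex coloring of $G$ such that for every non-isolated vertex $v$ and every color $c$, either no vertex of the open neighborhood $N_G(v)$ has color $c$, or color $c$ is used on an odd number of vertices of $N_G(v)$; $\chi_{\mathrm{so}}(G)$ is the minimum number of colors in such a coloring, and $\chi(G)$ is the chromatic number. For a plane (loopless) multigraph and a face $f$, let $V(f)$ denote the set of vertices on the boundary of $f$. A proper facially odd coloring of a $2$-connected plane multigraph $G$ is a proper vertex coloring such that for every face $f$ and every color $c$, the number of vertices of $V(f)$ having color $c$ is zero or odd; $\chi_{\mathrm{pfo}}(G)$ is the minimum number of colors in such a coloring. $\chi_{\mathrm{pfo}}(\mathcal{P})$ denotes the maximum of $\chi_{\mathrm{pfo}}(G)$ over all $2$-connected loopless multigraphs $G$ embedded in the plane, and $\chi_{\mathrm{pfo}}(\mathcal{P}_o)$ denotes the maximum of $\chi_{\mathrm{pfo}}(G)$ over all $2$-connected outerplanar graphs $G$ (with their outerplane embeddings). A graph is outerplanar if it has a plane embedding in which all vertices lie on the boundary of a single face. *)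

(* Defs.v *)
(* Plane (multi)graphs are encoded as combinatorial maps
   (rotation systems): darts D, a fixed-point-free involution alpha (edges),
   a permutation sigma (vertices = sigma-orbits), faces = orbits of
   phi = sigma \o alpha; genus 0 is expressed by Euler's formula. *)
From mathcomp Require Import all_boot all_order all_fingroup.
Set Implicit Arguments. Unset Strict Implicit. Unset Printing Implicit Defensive.

Definition simple_graph (T : finType) (e : rel T) : Prop :=
  symmetric e /\ irreflexive e.

Definition proper_col (T : finType) (e : rel T) (k : nat)
    (f : {ffun T -> 'I_k}) : bool :=
  [forall x, forall y, e x y ==> (f x != f y)].

Definition strong_odd_col (T : finType) (e : rel T) (k : nat)
    (f : {ffun T -> 'I_k}) : bool :=
  proper_col e f &&
  [forall v, [exists u, e v u] ==>
     [forall c : 'I_k, (#|[set u | e v u & f u == c]| == 0)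
                       || odd #|[set u | e v u & f u == c]| ]].

(* chromatic number: least k admitting a proper k-coloring
   (#|T| colors always suffice, hence the default value) *)
Definition chi (T : finType) (e : rel T) : nat :=
  \big[minn/#|T|]_(k < #|T|.+1 | [exists f : {ffun T -> 'I_k}, proper_col e f]) k.

Definition chi_so (T : finType) (e : rel T) : nat :=
  \big[minn/#|T|]_(k < #|T|.+1 | [exists f : {ffun T -> 'I_k}, strong_odd_col e f]) k.

Section Maps.
Variable D : finType.

Definition face_perm (alpha sigma : D -> D) : D -> D := fun d => sigma (alpha d).

Definition maprel (alpha sigma : D -> D) : rel D :=
  [rel x y | (y == sigma x) || (y == alpha x)].

Definition edge_inv (alpha : D -> D) : Prop :=
  forall d, alpha (alpha d) = d /\ alpha d != d.

(* Euler's formula V - E + F = 2 * (#components), i.e. every component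
   has genus 0 (V counts sigma-orbits, E = #|D|/2, F counts phi-orbits) *)
Definition genus0 (alpha sigma : D -> D) : Prop :=
  fcard sigma D + fcard (face_perm alpha sigma) D
  = #|D| %/ 2 + 2 * n_comp (maprel alpha sigma) D.

Definition loopless_map (alpha sigma : D -> D) : Prop :=
  forall d, ~~ fconnect sigma d (alpha d).

Definition simple_map (alpha sigma : D -> D) : Prop :=
  forall x y, fconnect sigma x y -> fconnect sigma (alpha x) (alpha y) -> x = y.

Definition del_rel (alpha sigma : D -> D) (v : D) : rel D :=
  [rel x y | [&& ~~ fconnect sigma v x, ~~ fconnect sigma v y &
               fconnect sigma x y || (y == alpha x)]].

Definition two_connected_map (alpha sigma : D -> D) : Prop :=
  [/\ 3 <= fcard sigma D,
      forall x y, connect (maprel alpha sigma) x y &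
      forall v x y, ~~ fconnect sigma v x -> ~~ fconnect sigma v y ->
                    connect (del_rel alpha sigma v) x y].

Definition plane_2conn_multigraph (alpha sigma : {perm D}) : Prop :=
  [/\ edge_inv alpha, loopless_map alpha sigma,
      two_connected_map alpha sigma & genus0 alpha sigma].

Definition outerplane_2conn_graph (alpha sigma : {perm D}) : Prop :=
  [/\ plane_2conn_multigraph alpha sigma, simple_map alpha sigma &
      exists f0, forall y, exists z,
        fconnect (face_perm alpha sigma) f0 z /\ fconnect sigma y z].

(* vertex colorings are colorings of darts constant on sigma-orbits.
   Proper facially odd coloring: proper, and on every face f each color
   appears on 0 or an odd number of the vertices of V(f). *)
Definition face_color_count (alpha sigma : D -> D) (k : nat)
    (col : D -> 'I_k) (f0 : D) (c : 'I_k) : nat :=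
  #|[set froot sigma y | y in [pred y | fconnect (face_perm alpha sigma) f0 y
                                         & col y == c]]|.

Definition pfo_coloring (alpha sigma : D -> D) (k : nat) (col : D -> 'I_k) : Prop :=
  [/\ forall x, col (sigma x) = col x,
      forall x, col x != col (alpha x) &
      forall f0 c, face_color_count alpha sigma col f0 c = 0
                   \/ odd (face_color_count alpha sigma col f0 c)].

End Maps.

(* k is an upper bound for chi_pfo(P): every 2-connected loopless plane
   multigraph has a proper facially odd k-coloring *)
Definition pfo_bound_P (k : nat) : Prop :=
  forall (D : finType) (alpha sigma : {perm D}),
    plane_2conn_multigraph alpha sigma ->
    exists col : D -> 'I_k, pfo_coloring alpha sigma col.

Definition pfo_bound_Po (k : nat) : Prop :=
  forall (D : finType) (alpha sigma : {perm D}),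
    outerplane_2conn_graph alpha sigma ->
    exists col : D -> 'I_k, pfo_coloring alpha sigma col.

Definition dart (T : finType) (e : rel T) := {p : T * T | e p.1 p.2}.

Definition graph_map (T : finType) (e : rel T) (alpha sigma : {perm dart e}) : Prop :=
  [/\ forall d, val (alpha d) = ((val d).2, (val d).1),
      forall d, (val (sigma d)).1 = (val d).1 &
      forall d d', (val d).1 = (val d').1 -> fconnect sigma d d'].

Definition planar (T : finType) (e : rel T) : Prop :=
  exists alpha sigma : {perm dart e}, graph_map alpha sigma /\ genus0 alpha sigma.

Definition outerplanar (T : finType) (e : rel T) : Prop :=
  exists alpha sigma : {perm dart e},
    [/\ graph_map alpha sigma, genus0 alpha sigma &
        forall x, exists f0, connect (maprel alpha sigma) x f0 /\
          forall y, connect (maprel alpha sigma) x y -> exists z,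
            fconnect (face_perm alpha sigma) f0 z /\ (val z).1 = (val y).1].

(* Main.v *)
Require Import Defs.
From mathcomp Require Import all_boot all_order all_fingroup.
From mathcomp Require Import zify.
Set Implicit Arguments. Unset Strict Implicit. Unset Printing Implicit Defensive.

(** Colour the vertices by a proper chi-colouring and refine each class [A] by a
    k-colouring of [A] in which every neighbourhood [N(w) n A] is oddly coloured;
    the pairs of colours then form a strong odd colouring.

    For planar graphs, the bipartite graph between [A] and the vertices [w] is a
    plane hypermap. Replacing each [w] by a polygon through its neighbours and
    stellating the remaining faces gives, for each component, a 2-connected plane
    multigraph in which the polygon of [w] is a face with vertex set [N(w) n A]; its
    facially odd k-colouring is the one needed. Genus 0 is kept along the way
    because the Euler defect [|D| + 2 c(s, t) - #s - #t - #(s t)] of a pair of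
    permutations is nonnegative and does not grow when an orbit of [s] is split.

    For outerplanar graphs, the pentagon forces k >= 5. The sets [N(w) n A] do not
    cross along the outer face, and a noncrossing family of sets of integers has an
    odd colouring with five colours, by induction on intervals whose two ends have
    prescribed distinct colours. *)

(** No topology of the plane is invoked. Planarity is the equality case of an inequality that holds
    for every pair of permutations, and a configuration that would make the defect negative cannot
    occur; this replaces the Jordan curve argument against crossing neighbourhoods. In part (a),
    multigraphs enter because a white vertex with two black neighbours becomes a digon. Stellation
    secures 2-connectedness: it leaves only faces that meet each vertex at most once. In part (b),
    the same construction leaves the admissible class: digons are not simple, and the stellating
    vertices need not share a face with all the others. So [pfo_bound_Po] is used only through the
    number 5. Five letters suffice for a direct colouring because words with prescribed distinct
    ends, adjacent letters different and every letter used an odd number of times exist in all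
    lengths from two on: up to length five the letters can be distinct, and four further letters can
    be inserted without changing a parity. *)

(** * Orbits of permutations and their change under a transposition *)

Section Orbits.

Variable D : finType.
Implicit Types (s t : {perm D}) (x y z : D).

Lemma fconnect_perm_sym s : connect_sym (coerced_frel s).
Proof. exact: fconnect_sym perm_inj. Qed.

Lemma froot_perm s x : froot s (s x) = froot s x.
Proof. by apply/esym/(rootP (fconnect_perm_sym s)); apply: fconnect1. Qed.

Lemma froot_permV s x : froot s ((s^-1)%g x) = froot s x.
Proof. by rewrite -[in RHS](permKV s x) froot_perm. Qed.

Lemma porbit_fconnect s x y : (y \in porbit s x) = fconnect s x y.
Proof.
apply/porbitP/idP => [[i ->]|/iter_findex <-]; last first.
  by exists (findex s x y); rewrite permX.
by rewrite permX fconnect_iter.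
Qed.

Lemma card_porbits s : #|porbits s| = fcard s D.
Proof.
rewrite /n_comp_mem -(card_in_imset (f := porbit s)); last first.
  move=> x y /andP[/eqP rx _] /andP[/eqP ry _] /eqP.
  rewrite eq_porbit_mem porbit_fconnect => /(rootP (fconnect_perm_sym s)).
  by rewrite rx ry.
apply: eq_card => A; apply/imsetP/imsetP => -[x _ ->]; last by exists x.
exists (froot s x).
  by rewrite inE /= roots_root //; apply: fconnect_perm_sym.
by apply/eqP; rewrite eq_porbit_mem porbit_fconnect fconnect_perm_sym connect_root.
Qed.

Lemma fcard_tperm_split s x y :
  x != y -> fconnect s x y -> fcard (tperm x y * s)%g D = (fcard s D).+1.
Proof.
move=> nxy cxy; rewrite -!card_porbits.
have := porbits_mul_tperm s x y.
by rewrite nxy porbit_fconnect fconnect_perm_sym cxy /= addn0 addn1.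
Qed.

Lemma fcard_tperm_merge s x y :
  ~~ fconnect s x y -> (fcard (tperm x y * s)%g D).+1 = fcard s D.
Proof.
move=> cxy; rewrite -!card_porbits.
have := porbits_mul_tperm s x y.
have -> : x != y by apply: contraNneq cxy => ->.
by rewrite porbit_fconnect fconnect_perm_sym cxy /=; lia.
Qed.

Lemma fconnect_tperm_merge s x y :
  ~~ fconnect s x y -> fconnect (tperm x y * s)%g x y.
Proof.
move=> cxy; apply/negPn/negP => cxy'.
have := fcard_tperm_merge cxy; have := fcard_tperm_merge cxy'.
by rewrite mulgA tperm2 mul1g; lia.
Qed.

(** The relation itself is not symmetric, but a permutation of a finite set is undone by iterating
    it. *)
Lemma maprel_connect_sym s t : connect_sym (maprel s t).
Proof.
apply: symmetric_from_pre => x y /connectP[p e_p ->].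
elim: p x e_p => //= z p IHp x /andP[xz /IHp{}IHp]; apply: (connect_trans IHp).
case/orP: xz => /eqP ->.
  suff: subrel (fconnect t) (connect (maprel s t)).
    by apply; rewrite fconnect_perm_sym fconnect1.
  by apply: connect_sub => u v /eqP <-; apply: connect1; rewrite /maprel /= eqxx.
suff: subrel (fconnect s) (connect (maprel s t)).
  by apply; rewrite fconnect_perm_sym fconnect1.
by apply: connect_sub => u v /eqP <-; apply: connect1; rewrite /maprel /= eqxx orbT.
Qed.

Lemma maprel1 s t x : connect (maprel s t) x (s x).
Proof. by apply: connect1; rewrite /maprel /= eqxx orbT. Qed.

Lemma maprel2 s t x : connect (maprel s t) x (t x).
Proof. by apply: connect1; rewrite /maprel /= eqxx. Qed.

Lemma fconnect_maprel s t (u : {perm D}) :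
  (forall x, connect (maprel s t) x (u x)) ->
  subrel (fconnect u) (connect (maprel s t)).
Proof. by move=> H; apply: connect_sub => x y /eqP <-. Qed.

Lemma connect_maprel_sub s t (e : rel D) :
  (forall x, connect e x (s x)) -> (forall x, connect e x (t x)) ->
  subrel (connect (maprel s t)) (connect e).
Proof. by move=> Hs Ht; apply: connect_sub => x y /orP[] /eqP ->. Qed.

(** The permutation [s] itself carries the orbits of [s * t] to those of [t * s]. *)
Lemma fcard_conj s t : fcard (s * t)%g D = fcard (t * s)%g D.
Proof.
have adj : rel_adjunction s (coerced_frel (t * s)%g) (coerced_frel (s * t)%g) D.
  apply: strict_adjunction => //.
  - exact: fconnect_perm_sym.
  - exact: perm_inj.
  - by apply/subsetP => x _; rewrite -(permKV s x) codom_f.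
  - by move=> x y _; rewrite /= !permM (inj_eq perm_inj).
rewrite [RHS](adjunction_n_comp _ _ _ _ adj) //; exact: fconnect_perm_sym.
Qed.

Lemma fcard_invg s : fcard (s^-1)%g D = fcard s D.
Proof.
by apply: eq_n_comp => x y; rewrite -!porbit_fconnect porbitV.
Qed.

End Orbits.

(** * Comparing the numbers of components of two relations *)

(** Distinct [e']-roots in [B] have distinct [e]-roots. The filter [B] allows an exceptional
    component to be left uncounted. *)
Lemma leq_n_comp (D : finType) (e e' : rel D) (B : pred D) :
  connect_sym e -> connect_sym e' ->
  (forall z z', roots e' z -> roots e' z' -> B z -> B z' ->
     connect e z z' -> connect e' z z') ->
  #|predI (roots e') B| <= n_comp e D.
Proof.
move=> se se' H; rewrite -(card_in_imset (f := root e)); last first.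
  move=> z z' /andP[rz Bz] /andP[rz' Bz'] /(rootP se).
  move/(H _ _ rz rz' Bz Bz')/(rootP se').
  by rewrite (eqP rz) (eqP rz').
apply: subset_leq_card; apply/subsetP => _ /imsetP[z _ ->].
by rewrite inE /= roots_root.
Qed.

Lemma leq_n_comp_sub (D : finType) (e e' : rel D) :
  connect_sym e -> connect_sym e' -> subrel (connect e) (connect e') ->
  n_comp e' D <= n_comp e D.
Proof. by move=> se se' H; apply: leq_n_comp => // z z' _ _ _ _ /H. Qed.

(** Along an [e]-path the [e']-component can change only between those of [x] and [y]. Once the
    component of [x] is set aside, the remaining ones stay apart. *)
Lemma leq_n_compS (D : finType) (e e' : rel D) (x y : D) :
  connect_sym e -> connect_sym e' ->
  (forall u v, e u v ->
     [|| connect e' u v | (connect e' u x || connect e' u y)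
                        && (connect e' v x || connect e' v y)]) ->
  n_comp e' D <= (n_comp e D).+1.
Proof.
move=> se se' H.
have Hc u v : connect e u v ->
    [|| connect e' u v | (connect e' u x || connect e' u y)
                       && (connect e' v x || connect e' v y)].
  move/connectP => [p e_p ->]; elim: p u e_p => [|w p IHp] u /=.
    by rewrite connect0.
  move=> /andP[/H uw /IHp {IHp}]; set v' := last _ _.
  case/orP: uw => [uw|/andP[ux wx]].
    by rewrite !(same_connect se' uw).
  case/orP => [wv|/andP[_ ->]]; last by rewrite ux orbT.
  by rewrite -!(same_connect se' wv) ux wx orbT.
rewrite /n_comp_mem (cardD1 (root e' x)) -add1n leq_add //; first exact: leq_b1.
apply: leq_trans (leq_n_comp (B := [pred z | z != root e' x]) se se' _).
  by apply: subset_leq_card; apply/subsetP => z; rewrite !inE andbT andbC.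
move=> z z' rz rz' /= nz nz' /Hc.
have xF w : roots e' w -> w != root e' x -> connect e' w x = false.
  move=> rw nw; apply: contraNF nw => /(rootP se').
  by rewrite (eqP rw) => ->.
rewrite !xF //= => /orP[//|/andP[zy z'y]].
by rewrite (same_connect se' zy) se'.
Qed.

(** * Euler's inequality for pairs of permutations, and genus 0 *)

Section Euler.

Variable D : finType.
Implicit Types (s t : {perm D}) (x y z : D).

Lemma n_comp_tperm_le s t x y :
  n_comp (maprel (tperm x y * s)%g t) D <= (n_comp (maprel s t) D).+1.
Proof.
apply: (@leq_n_compS _ _ _ x y); try exact: maprel_connect_sym.
have sy w : connect (maprel (tperm x y * s)%g t) w (s (tperm x y w)).
  by rewrite -permM maprel1.
move=> u v /orP[] /eqP ->; first by rewrite maprel2.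
case: (tpermP x y u) (sy u) => [->|->|_ _ ->] //.
- move=> _; have := sy y; rewrite tpermR => h.
  by rewrite connect0 /= orbC maprel_connect_sym [connect _ (s x) y]maprel_connect_sym h orbT.
- move=> _; have := sy x; rewrite tpermL => h.
  by rewrite connect0 /= orbT [connect _ (s y) x]maprel_connect_sym h orbT.
Qed.

Lemma n_comp_tperm_connected s t x y :
  connect (maprel (tperm x y * s)%g t) x y ->
  n_comp (maprel (tperm x y * s)%g t) D <= n_comp (maprel s t) D.
Proof.
move=> cxy; apply: leq_n_comp_sub; try exact: maprel_connect_sym.
have sy w : connect (maprel (tperm x y * s)%g t) w (s (tperm x y w)).
  by rewrite -permM maprel1.
apply: connect_maprel_sub => w; last exact: maprel2.
case: (tpermP x y w) (sy w) => [->|->|_ _ ->] //.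
  by move=> _; apply: connect_trans cxy _; have := sy y; rewrite tpermR.
move=> _; rewrite maprel_connect_sym in cxy.
by apply: connect_trans cxy _; have := sy x; rewrite tpermL.
Qed.

(* The genus cannot increase when an orbit of [s] is split in two: the number of
   components grows only if the orbit of [s * t] is split as well. *)
Lemma euler_step s t x y : x != y -> fconnect s x y ->
  fcard s D + fcard (s * t)%g D + 2 * n_comp (maprel (tperm x y * s)%g t) D <=
  fcard (tperm x y * s)%g D + fcard (tperm x y * s * t)%g D
    + 2 * n_comp (maprel s t) D.
Proof.
move=> nxy cxy; rewrite (fcard_tperm_split nxy cxy) -mulgA.
have [cst|ncst] := boolP (fconnect (s * t)%g x y).
  rewrite (fcard_tperm_split nxy cst).
  by have := n_comp_tperm_le s t x y; lia.
have := fcard_tperm_merge ncst.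
suff: connect (maprel (tperm x y * s)%g t) x y.
  by move/n_comp_tperm_connected => h1 <-; rewrite addSn addnS leq_add2l leq_mul2l.
apply: fconnect_maprel (fconnect_tperm_merge ncst) => z.
by rewrite mulgA permM; apply: connect_trans (maprel1 _ _ _) (maprel2 _ _ _).
Qed.

(** Cuts [x] out of its cycle, its predecessor jumping to [s x]. Written with a transposition, this
    is a single split to which [euler_step] applies. *)
Definition isolate s x := (tperm x (s^-1 x) * s)%g.

Lemma isolate_fix s x : isolate s x x = x.
Proof. by rewrite permM tpermL permKV. Qed.

Lemma isolate_step s x z : isolate s x z = if z == x then x
  else if s z == x then s x else s z.
Proof.
have [->|nzx] := eqVneq z x; first exact: isolate_fix.
rewrite permM; have [<-|nsz] := eqVneq (s z) x.
  by rewrite permK tpermR.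
by rewrite tpermD // eq_sym // -(inj_eq (@perm_inj _ s)) permKV.
Qed.

Lemma isolate_id s x : s x = x -> isolate s x = s.
Proof.
move=> sx; apply/permP => z; rewrite isolate_step.
case: eqVneq => [->|nzx]; first by rewrite sx.
by case: eqVneq => // szx; rewrite szx sx.
Qed.

(** Euler's formula for hypermaps of genus 0, with [s] not assumed to be an involution. For a
    fixed-point-free involution [s], twice the number of its orbits is [#|D|], and [genus0]
    reappears. *)
Definition planar_pair s t :=
  fcard s D + fcard t D + fcard (s * t)%g D = #|D| + 2 * n_comp (maprel s t) D.

Lemma isolate_euler s t x :
  fcard s D + fcard (s * t)%g D + 2 * n_comp (maprel (isolate s x) t) D <=
  fcard (isolate s x) D + fcard (isolate s x * t)%g D
    + 2 * n_comp (maprel s t) D.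
Proof.
have [sx|nsx] := eqVneq (s x) x; first by rewrite isolate_id.
apply: euler_step.
  by apply: contraNneq nsx => {1}->; rewrite permKV.
by rewrite fconnect_perm_sym -{2}(permKV s x) fconnect1.
Qed.

(* [remove_seq q s] fixes [q] and is the first-return map of [s] outside [q]. *)
Fixpoint remove_seq (q : seq D) s : {perm D} :=
  if q is x :: q' then isolate (remove_seq q' s) x else s.

Definition remove (Q : {set D}) s := remove_seq (enum Q) s.

Lemma remove_seq_fix q s x : x \in q -> remove_seq q s x = x.
Proof.
elim: q => //= y q IHq; rewrite inE isolate_step.
by case: eqVneq => [->|nxy] //= xq; rewrite IHq // (negPf nxy).
Qed.

Lemma remove_seq_notin q s x : x \notin q -> remove_seq q s x \notin q.
Proof.
elim: q x => //= y q IHq x; rewrite !inE negb_or => /andP[nxy nxq].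
rewrite isolate_step (negPf nxy).
have [uxy|nux] := eqVneq (remove_seq q s x) y; last by rewrite (negPf nux) IHq.
have nyq : y \notin q by rewrite -uxy IHq.
rewrite negb_or; apply/andP; split; last exact: IHq.
apply: contraNneq nxy => uyy.
by apply/eqP/(@perm_inj _ (remove_seq q s)); rewrite uxy uyy.
Qed.

Lemma remove_seq_fconnect q s x y : x \notin q -> y \notin q ->
  fconnect (remove_seq q s) x y = fconnect s x y.
Proof.
elim: q x y => //= w q IHq x y.
rewrite !inE !negb_or => /andP[nxw nxq] /andP[nyw nyq].
rewrite -IHq //; move: (remove_seq q s) => {IHq nxq nyq q}u.
apply/idP/idP.
  suff: subrel (fconnect (isolate u w)) (fconnect u) by apply.
  apply: connect_sub => a b /eqP <-; rewrite isolate_step.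
  case: eqP => [->|_]; first exact: connect0.
  case: eqP => [<-|_]; last exact: fconnect1.
  exact: (fconnect_iter _ 2).
(* The [u]-walk from [z] is followed with each visit to [w] replaced by its successor [u w]. *)
move=> cxy; suff H n : forall z, z != w -> fconnect (isolate u w) z
    (if iter n u z == w then u w else iter n u z).
  by have := H (findex u x y) x nxw; rewrite iter_findex // (negPf nyw).
elim: n => [|n IHn] z nz /=; first by rewrite (negPf nz).
apply: connect_trans (IHn z nz) _.
case: (eqVneq (iter n u z) w) => [->|nn].
  by case: eqP => // ->.
have := fconnect1 (isolate u w) (iter n u z).
by rewrite isolate_step (negPf nn); case: eqP.
Qed.

Implicit Type Q : {set D}.

Lemma remove_fix Q s x : x \in Q -> remove Q s x = x.
Proof. by move=> xQ; rewrite remove_seq_fix // mem_enum. Qed.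

Lemma remove_notin Q s x : x \notin Q -> remove Q s x \notin Q.
Proof.
by move=> xQ; have := @remove_seq_notin (enum Q) s x; rewrite !mem_enum; apply.
Qed.

Lemma remove_fconnect Q s x y : x \notin Q -> y \notin Q ->
  fconnect (remove Q s) x y = fconnect s x y.
Proof. by move=> xQ yQ; rewrite remove_seq_fconnect // mem_enum. Qed.

Lemma remove_seq_step q s x : x \notin q -> s x \notin q -> remove_seq q s x = s x.
Proof.
elim: q => //= y q IHq; rewrite !inE !negb_or => /andP[nxy nxq] /andP[nsy nsq].
by rewrite isolate_step (negPf nxy) IHq // (negPf nsy).
Qed.

Lemma remove_seq_step2 q s x :
  x \notin q -> s x \in q -> s (s x) \notin q -> remove_seq q s x = s (s x).
Proof.
elim: q => //= y q IHq; rewrite !inE !negb_or => /andP[nxy nxq].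
move=> sxyq /andP[nssy nssq]; rewrite isolate_step (negPf nxy).
have [sxq|sxq] := boolP (s x \in q); first by rewrite IHq // (negPf nssy).
have sxy : s x = y by move: sxyq; rewrite (negPf sxq) orbF => /eqP.
by rewrite remove_seq_step // sxy eqxx remove_seq_step // -sxy.
Qed.

Lemma remove_step Q s x : x \notin Q -> s x \notin Q -> remove Q s x = s x.
Proof. by move=> *; rewrite remove_seq_step // mem_enum. Qed.

Lemma remove_step2 Q s x :
  x \notin Q -> s x \in Q -> s (s x) \notin Q -> remove Q s x = s (s x).
Proof. by move=> *; rewrite remove_seq_step2 // mem_enum. Qed.

Lemma euler_remove s t Q :
  fcard s D + fcard (s * t)%g D + 2 * n_comp (maprel (remove Q s) t) D <=
  fcard (remove Q s) D + fcard (remove Q s * t)%g D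
    + 2 * n_comp (maprel s t) D.
Proof.
rewrite /remove; elim: (enum Q) => //= x q IHq.
have := isolate_euler (remove_seq q s) t x.
move: IHq; set a := fcard _ _; set b := fcard _ _; set c := n_comp _ _.
set d := fcard _ _; set e := fcard _ _; set f := n_comp _ _; set g := n_comp _ _.
set h := fcard _ _; set k := fcard _ _; lia.
Qed.

(** Removing every dart turns [s] into the identity, for which the formula is an equality: there are
    [#|D|] orbits of [s], and the components are the orbits of [t]. *)
Lemma euler_bound s t :
  fcard s D + fcard t D + fcard (s * t)%g D <= #|D| + 2 * n_comp (maprel s t) D.
Proof.
have := euler_remove s t [set: D].
have -> : remove [set: D] s = 1%g.
  by apply/permP => x; rewrite remove_fix ?inE // perm1.
rewrite mul1g.
have -> : fcard (1%g : {perm D}) D = #|D|.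
  by rewrite -[RHS]fcard_id; apply: eq_fcard => x; rewrite perm1.
have -> : n_comp (maprel (1%g : {perm D}) t) D = fcard t D.
  apply: eq_n_comp => x y; apply/idP/idP; last exact: fconnect_maprel (maprel2 _ _) _ _.
  by apply: connect_maprel_sub => z; rewrite ?perm1 ?connect0 ?fconnect1.
set a := fcard _ _; set b := fcard _ _; set c := n_comp _ _.
set d := n_comp _ _; lia.
Qed.

Lemma planar_pair_remove s t Q : planar_pair s t -> planar_pair (remove Q s) t.
Proof.
move=> pst; have := euler_remove s t Q; have := euler_bound (remove Q s) t.
move: pst; rewrite /planar_pair.
set a := n_comp _ _; set b := n_comp _ _; set c := n_comp _ _.
set d := n_comp _ _; set e := n_comp _ _; set f := n_comp _ _; set g := n_comp _ _.
lia.
Qed.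

Lemma planar_pairC s t : planar_pair s t -> planar_pair t s.
Proof.
rewrite /planar_pair fcard_conj [_ + fcard t D]addnC => ->; congr (_ + 2 * _).
by apply: eq_n_comp; apply: eq_connect => x y; rewrite /maprel /= orbC.
Qed.

(** The product of the new pair is [t]: vertices, edges and faces play symmetric roles. This makes
    the product permutation accessible to [remove]. *)
Lemma planar_pair_mul s t : planar_pair s t -> planar_pair s^-1%g (s * t)%g.
Proof.
rewrite /planar_pair fcard_invg mulKg addnAC => ->; congr (_ + 2 * _).
have cV (u v : {perm D}) z : connect (maprel u v) z (u^-1%g z).
  by rewrite maprel_connect_sym; have := maprel1 u v (u^-1%g z); rewrite permKV.
apply: eq_n_comp => x y; apply/idP/idP; apply: connect_maprel_sub => z.
- by have := cV s^-1%g (s * t)%g z; rewrite invgK.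
- have := maprel2 s^-1%g (s * t)%g (s^-1%g z); rewrite permM permKV.
  by apply: connect_trans; apply: maprel1.
- exact: cV.
- by rewrite permM; apply: connect_trans (maprel1 _ _ _) (maprel2 _ _ _).
Qed.

End Euler.

(** * Transfer of orbit counts, and connectivity after deleting a vertex *)

Lemma face_permE (D : finType) (al sg : {perm D}) :
  fconnect (face_perm al sg) =2 fconnect (al * sg)%g.
Proof. by apply: eq_connect => x y; rewrite /= permM. Qed.

(** Here [h] embeds [C] as representatives of the [f]-orbits inside [A], and [k] names a
    representative for each dart of [A]. *)
Lemma n_comp_transfer (D C : finType) (f : {perm D}) (s : {perm C}) (A : pred D)
    (h : C -> D) (k : D -> C) :
  (forall d, A (f d) = A d) -> (forall x, A (h x)) ->
  (forall d, A d -> fconnect f d (h (k d))) ->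
  (forall x y, fconnect f (h x) (h y) = fconnect s x y) ->
  fcard f A = fcard s C.
Proof.
move=> Af Ah fk fs.
have adj : rel_adjunction h (coerced_frel f) (coerced_frel s) A.
  by split=> [x Ax|x' y' _]; [exists (k x); apply: fk | rewrite fs].
rewrite (adjunction_n_comp _ _ _ _ adj); try exact: fconnect_perm_sym.
  by apply: eq_n_comp_r => x; rewrite !inE; apply: Ah.
by move=> x _ /eqP <-; apply/esym/Af.
Qed.

(* Deleting a vertex [v] keeps the map connected: consecutive neighbours of [v]
   are joined by the rest of the face boundary that runs between them, which
   avoids [v]. *)
Lemma del_rel_connected (D : finType) (al sg : {perm D}) :
  edge_inv al -> loopless_map al sg ->
  (forall x y, connect (maprel al sg) x y) ->
  (forall x y, fconnect (face_perm al sg) x y -> fconnect sg x y -> x = y) ->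
  forall v x y, ~~ fconnect sg v x -> ~~ fconnect sg v y ->
    connect (del_rel al sg v) x y.
Proof.
move=> alK loopless conn face_simple v.
have fsym := fconnect_perm_sym sg.
have esym : connect_sym (del_rel al sg v).
  apply: sym_connect_sym => x y; rewrite /del_rel /= andbCA; congr [&& _, _ & _ || _].
    exact: fsym.
  by apply/eqP/eqP => ->; rewrite (alK _).1.
have edge x y : ~~ fconnect sg v x -> ~~ fconnect sg v y ->
    fconnect sg x y || (y == al x) -> connect (del_rel al sg v) x y.
  by move=> vx vy xy; apply: connect1; rewrite /del_rel /= vx vy.
have alN x : fconnect sg v x -> ~~ fconnect sg v (al x).
  by move=> vx; rewrite (same_connect fsym vx) loopless.
have turn x : fconnect sg v x -> connect (del_rel al sg v) (al (sg x)) (al x).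
  move=> vx; set y := sg x.
  have vy : fconnect sg v y by rewrite -(same_connect_r fsym (fconnect1 sg x)).
  have avoid i : 0 < i < fingraph.order (al * sg)%g y ->
      ~~ fconnect sg v (iter i (al * sg)%g y).
    move=> /andP[i0 lti]; apply/negP => vi.
    suff yi : y = iter i (al * sg)%g y.
      by have := findex_iter lti; rewrite -yi findex0; lia.
    apply: face_simple; first by rewrite face_permE fconnect_iter.
    by rewrite -(same_connect fsym vy).
  have walk i : 0 < i < fingraph.order (al * sg)%g y ->
      connect (del_rel al sg v) (al y) (iter i (al * sg)%g y).
    elim: i => // i IHi /andP[_ lti].
    have vi := avoid i.+1 lti; move: (vi).
    case: i IHi lti vi => [|i] IHi lti vi.
      by rewrite /= permM => vs; apply: edge; rewrite ?alN ?fconnect1.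
    rewrite /= permM; set z := (_ (iter _ _ _)); move=> vz.
    have vz' : ~~ fconnect sg v z by apply: (avoid i.+1); rewrite /= (ltnW lti).
    have vaz : ~~ fconnect sg v (al z).
      by rewrite (same_connect_r fsym (fconnect1 sg (al z))).
    apply: connect_trans (IHi _) _; first by rewrite /= (ltnW lti).
    apply: connect_trans (edge _ (al z) _ _ _) (edge _ _ _ _ _) => //.
      by rewrite eqxx orbT.
    by rewrite fconnect1.
  have last_step : iter (fingraph.order (al * sg)%g y).-1 (al * sg)%g y = al x.
    apply: (@perm_inj _ (al * sg)%g); rewrite -iterS orderSpred iter_order //.
      by rewrite permM (alK _).1.
    exact: perm_inj.
  rewrite -last_step; apply: walk.
  have := orderSpred (al * sg)%g y.
  case: (fingraph.order _ y).-1 last_step => [/= yx|n _ <-]; last by rewrite ltnSn.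
  by have := alN _ vx; rewrite -yx vy.
set n0 := al v.
(* A dart at [v] is represented by its opposite, which is not at [v]; so [Q] makes sense on all
   darts and can be propagated along the undeleted map. *)
pose Q x := if fconnect sg v x then connect (del_rel al sg v) (al x) n0
            else connect (del_rel al sg v) x n0.
have Qstep x y : maprel al sg x y -> Q x -> Q y.
  rewrite /Q => /orP[] /eqP ->.
    rewrite -(same_connect_r fsym (fconnect1 sg x)).
    case: ifP => [vx|/negbT vx]; first exact/connect_trans/turn.
    apply: connect_trans; rewrite esym; apply: edge => //.
      by rewrite -(same_connect_r fsym (fconnect1 sg x)).
    by rewrite fconnect1.
  case: ifP => [vx|/negbT vx]; first by rewrite (negPf (alN _ vx)).
  case: ifP => [vax|/negbT vax]; first by rewrite (alK x).1.
  by apply: connect_trans; rewrite esym; apply: edge; rewrite ?eqxx ?orbT.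
have Qall x : Q x.
  have /connectP[p e_p ->] := conn v x.
  have : Q v by rewrite /Q connect0.
  by elim: p (v) e_p => //= y p IHp u /andP[/Qstep uy /IHp IH] /uy/IH.
move=> x y vx vy; have := Qall x; have := Qall y.
by rewrite /Q (negPf vx) (negPf vy) [connect _ y n0]esym => yn /connect_trans; apply.
Qed.

(* The plane multigraph of a connected genus-0 hypermap [(a, b)], whose
   [a]-orbits are the black vertices and [b]-orbits the white ones: each white
   vertex becomes a polygon through its black neighbours, and each face of the
   hypermap (a [g]-orbit) is stellated by a new vertex. A dart [x] of the
   hypermap gives four darts: [bout x] and [bin x], the two polygon sides met
   around a black vertex at [x], [spoke x] from the black vertex towards the
   centre of the following face, and [hub x] back. *)
Section Stellation.

Variables (C : finType) (a b : {perm C}).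

Let g := ((a * b)^-1)%g.

Definition stell := (C * (bool * bool))%type.

Definition bout (x : C) : stell := (x, (false, false)).
Definition bin (x : C) : stell := (x, (false, true)).
Definition spoke (x : C) : stell := (x, (true, false)).
Definition hub (x : C) : stell := (x, (true, true)).

Definition stell_sigma_fun (d : stell) : stell :=
  match d.2 with
  | (false, false) => bin d.1
  | (false, true) => spoke d.1
  | (true, false) => bout (a d.1)
  | (true, true) => hub (g d.1)
  end.

Definition stell_sigma_inv (d : stell) : stell :=
  match d.2 with
  | (false, false) => spoke ((a^-1)%g d.1)
  | (false, true) => bout d.1
  | (true, false) => bin d.1
  | (true, true) => hub ((g^-1)%g d.1)
  end.

Definition stell_alpha_fun (d : stell) : stell :=
  match d.2 with
  | (false, false) => bin (b d.1)
  | (false, true) => bout ((b^-1)%g d.1)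
  | (true, false) => hub d.1
  | (true, true) => spoke d.1
  end.

Lemma stell_sigma_funK : cancel stell_sigma_fun stell_sigma_inv.
Proof. by move=> [x [[] []]]; rewrite /stell_sigma_inv /= ?permK. Qed.

Lemma stell_alpha_funK : involutive stell_alpha_fun.
Proof. by move=> [x [[] []]]; rewrite /stell_alpha_fun /= ?permK ?permKV. Qed.

Definition stell_sigma : {perm stell} := perm (can_inj stell_sigma_funK).
Definition stell_alpha : {perm stell} := perm (inv_inj stell_alpha_funK).

Let phi := (stell_alpha * stell_sigma)%g.

Lemma stell_sigmaE d : stell_sigma d = stell_sigma_fun d.
Proof. exact: permE. Qed.

Lemma stell_alphaE d : stell_alpha d = stell_alpha_fun d.
Proof. exact: permE. Qed.

Lemma stell_phiE d : phi d = stell_sigma_fun (stell_alpha_fun d).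
Proof. by rewrite permM stell_alphaE stell_sigmaE. Qed.

Definition at_hub (d : stell) := d.2 == (true, true).

Definition stell_vertex (d : stell) :=
  (at_hub d, if at_hub d then froot g d.1 else froot a d.1).

Lemma stell_vertex_inv d d' : fconnect stell_sigma d d' ->
  stell_vertex d = stell_vertex d'.
Proof.
apply: (fconnect_invariant (k := stell_vertex)) => {d'}[[x [[] []]]];
  rewrite /= stell_sigmaE /stell_vertex /= ?froot_perm; exact: eqxx.
Qed.

Lemma stell_sigma_hub x y : fconnect stell_sigma (hub x) (hub y) = fconnect g x y.
Proof.
apply/idP/idP => [/stell_vertex_inv[] /(rootP (fconnect_perm_sym g)) //|].
move/iter_findex <-; elim: (findex g x y) => //= n; move/connect_trans; apply.
by have := fconnect1 stell_sigma (hub (iter n g x)); rewrite stell_sigmaE.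
Qed.

Lemma stell_sigma_bin d : ~~ at_hub d -> fconnect stell_sigma d (bin d.1).
Proof.
case: d => x [[] []] //= _.
  rewrite fconnect_perm_sym.
  by have := fconnect1 stell_sigma (bin x); rewrite stell_sigmaE.
by have := fconnect1 stell_sigma (bout x); rewrite stell_sigmaE.
Qed.

Lemma stell_sigma_black d d' : ~~ at_hub d -> ~~ at_hub d' ->
  fconnect stell_sigma d d' = fconnect a d.1 d'.1.
Proof.
move=> nd nd'; apply/idP/idP.
  move=> /stell_vertex_inv; rewrite /stell_vertex (negPf nd) (negPf nd') => -[].
  by move/(rootP (fconnect_perm_sym a)).
suff H x y : fconnect a x y -> fconnect stell_sigma (bin x) (bin y).
  move/H/(connect_trans (stell_sigma_bin nd))/connect_trans; apply.
  by rewrite fconnect_perm_sym stell_sigma_bin.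
move/iter_findex <-; elim: (findex a x y) => //= n; move/connect_trans; apply.
set z := iter n a x; apply: connect_trans (stell_sigma_bin (d := bout (a z)) _) => //.
by have := fconnect_iter stell_sigma 2 (bin z); rewrite /= !stell_sigmaE.
Qed.

Lemma stell_sigma_hub_black d d' :
  at_hub d -> ~~ at_hub d' -> fconnect stell_sigma d d' = false.
Proof.
move=> hd nd; apply/negP => /stell_vertex_inv.
by rewrite /stell_vertex hd (negPf nd).
Qed.

Definition stell_is_bin (d : stell) := d.2 == (false, true).

(** Each face other than a polygon is a triangle [bout x], [spoke (b x)], [hub (g (b x))], with
    exactly one polygon side; the value is its [x]. On [bin] darts the value is irrelevant. *)
Definition stell_tri (d : stell) :=
  match d.2 with
  | (true, false) => (b^-1)%g d.1
  | (true, true) => a d.1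
  | _ => d.1
  end.

Definition stell_face (d : stell) :=
  (stell_is_bin d, if stell_is_bin d then froot b d.1 else stell_tri d).

Lemma agb x : a (g (b x)) = x.
Proof. by rewrite /g invMg permM permK permKV. Qed.

Lemma ag x : a (g x) = (b^-1)%g x.
Proof. by rewrite -{1}(permKV b x) agb. Qed.

Lemma stell_face_inv d d' : fconnect phi d d' -> stell_face d = stell_face d'.
Proof.
apply: (fconnect_invariant (k := stell_face)) => {d'}[[x [[] []]]];
  rewrite /= stell_phiE /stell_face /stell_tri /= ?froot_permV ?permK ?ag ?eqxx //.
Qed.

Lemma stell_phi_bin x y : fconnect phi (bin x) (bin y) = fconnect b x y.
Proof.
apply/idP/idP => [/stell_face_inv[] /(rootP (fconnect_perm_sym b)) //|].
rewrite fconnect_perm_sym => /iter_findex <-.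
rewrite fconnect_perm_sym; elim: (findex b y x) => //= n; move/connect_trans; apply.
rewrite fconnect_perm_sym.
have := fconnect1 phi (bin (b (iter n b y))).
by rewrite stell_phiE /stell_sigma_fun /= permK.
Qed.

Lemma stell_phi_tri d : ~~ stell_is_bin d -> fconnect phi d (bout (stell_tri d)).
Proof.
case: d => x [[] []] //= _.
  by have := fconnect1 phi (hub x); rewrite stell_phiE.
have := fconnect_iter phi 2 (spoke x); rewrite /= !stell_phiE.
by rewrite /stell_sigma_fun /= /stell_tri /= ag.
Qed.

Lemma stell_phi_bout x y : fconnect phi (bout x) (bout y) = (x == y).
Proof.
by apply/idP/eqP => [/stell_face_inv[]|->].
Qed.

Lemma fcard_stell_sigma : fcard stell_sigma {: stell} = fcard a C + fcard (a * b)%g C.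
Proof.
rewrite (n_compC at_hub) addnC; congr (_ + _).
  apply: (n_comp_transfer (h := bin) (k := fst)) => //.
  - move=> [x [[] []]]; rewrite /= stell_sigmaE //.
  - by move=> d /stell_sigma_bin.
  - by move=> x y; rewrite stell_sigma_black.
rewrite -[RHS]fcard_invg.
apply: (n_comp_transfer (h := hub) (k := fst)) => //.
- by move=> [x [[] []]]; rewrite /= stell_sigmaE.
- by move=> [x [[] []]] // _; apply: connect0.
- exact: stell_sigma_hub.
Qed.

Lemma fcard_stell_phi : fcard phi {: stell} = fcard b C + #|C|.
Proof.
rewrite (n_compC stell_is_bin); congr (_ + _).
  apply: (n_comp_transfer (h := bin) (k := fst)) => //.
  - by move=> [x [[] []]]; rewrite /= stell_phiE.
  - by move=> [x [[] []]] // _; apply: connect0.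
  - exact: stell_phi_bin.
have -> : #|C| = fcard (1%g : {perm C}) C.
  by rewrite -[LHS]fcard_id; apply: eq_fcard => x; rewrite perm1.
apply: (n_comp_transfer (h := bout) (k := stell_tri)) => //.
- by move=> [x [[] []]]; rewrite /= stell_phiE.
- by move=> d /stell_phi_tri.
- move=> x y; rewrite stell_phi_bout; apply/eqP/idP => [->|]; first exact: connect0.
  by move/iter_findex <-; elim: (findex _ x y) => //= n <-; rewrite perm1.
Qed.

Variable x0 : C.
Hypothesis conn : forall x y, connect (maprel a b) x y.
Hypothesis planar_ab : planar_pair a b.
Hypothesis b_nofix : forall x, b x != x.
Hypothesis ab_simple : forall x y, fconnect a x y -> fconnect b x y -> x = y.

Lemma stell_ab_neq x : ~~ fconnect a x (b x).
Proof.
by apply: contra (b_nofix x) => axb; rewrite -(ab_simple axb) ?fconnect1.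
Qed.

Lemma stell_edge_inv : edge_inv stell_alpha.
Proof.
move=> d; rewrite !stell_alphaE stell_alpha_funK; split=> //.
by case: d => x [[] []]; rewrite /stell_alpha_fun -!pair_eqE /= ?andbF.
Qed.

Lemma stell_loopless : loopless_map stell_alpha stell_sigma.
Proof.
move=> [x [[] []]]; rewrite stell_alphaE /=.
- by rewrite stell_sigma_hub_black.
- by rewrite fconnect_perm_sym stell_sigma_hub_black.
- rewrite stell_sigma_black //= fconnect_perm_sym.
  by rewrite -{2}(permKV b x) stell_ab_neq.
- by rewrite stell_sigma_black //= stell_ab_neq.
Qed.

Lemma stell_connected d d' : connect (maprel stell_alpha stell_sigma) d d'.
Proof.
have symM := maprel_connect_sym stell_alpha stell_sigma.
have sub : subrel (fconnect stell_sigma) (connect (maprel stell_alpha stell_sigma)).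
  by apply: fconnect_maprel => z; apply: maprel2.
have toI e : connect (maprel stell_alpha stell_sigma) e (bin e.1).
  have [he|ne] := boolP (at_hub e); last exact/sub/stell_sigma_bin.
  apply: connect_trans (maprel1 _ _ _) _.
  rewrite stell_alphaE; case: e he => x [[] []] // _ /=.
  exact/sub/(stell_sigma_bin (d := spoke x)).
have II x y : connect (maprel stell_alpha stell_sigma) (bin x) (bin y).
  have /connectP[p e_p ->] := conn x y.
  elim: p x e_p => //= z p IHp x /andP[xz /IHp h]; apply: connect_trans h.
  case/orP: xz => /eqP ->.
    apply: (@connect_trans _ _ (bout x)).
      by apply: sub; rewrite stell_sigma_black.
    by have := maprel1 stell_alpha stell_sigma (bout x); rewrite stell_alphaE.
  by apply: sub; rewrite stell_sigma_black //= fconnect1.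
apply: connect_trans (toI _) (connect_trans (II _ d'.1) _).
by rewrite symM.
Qed.

(** A polygon visits a black vertex once by [ab_simple]. A triangle has one hub corner and two black
    corners, which differ by [stell_ab_neq]. This is the hypothesis of [del_rel_connected]. *)
Lemma stell_face_simple d d' :
  fconnect (face_perm stell_alpha stell_sigma) d d' -> fconnect stell_sigma d d' ->
  d = d'.
Proof.
rewrite face_permE => /stell_face_inv fE vE; move: fE.
have nab x : fconnect a ((b^-1)%g x) x = false.
  by apply/negbTE; rewrite -{2}(permKV b x) stell_ab_neq.
case: d d' vE => x [[] []] [y [[] []]]; rewrite /stell_face /stell_tri /= => vE [] //.
- by move/perm_inj ->.
- by rewrite stell_sigma_hub_black in vE.
- by rewrite stell_sigma_hub_black in vE.
- by rewrite fconnect_perm_sym stell_sigma_hub_black in vE.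
- by move/perm_inj ->.
- by move=> xy; rewrite fconnect_perm_sym stell_sigma_black //= -xy nab in vE.
- rewrite stell_sigma_black //= in vE.
  by move/(rootP (fconnect_perm_sym b)) => /(ab_simple vE) ->.
- by rewrite fconnect_perm_sym stell_sigma_hub_black in vE.
- by move=> xy; rewrite stell_sigma_black //= xy nab in vE.
- by move=> ->.
Qed.

(** The vertices number [#a + #(a b)], the edges [2 * #|C|] and the faces [#b + #|C|], so Euler's
    formula for the stellation is [planar_pair a b] rearranged. *)
Lemma stell_genus0 : genus0 stell_alpha stell_sigma.
Proof.
rewrite /genus0.
have -> : fcard (face_perm stell_alpha stell_sigma) {: stell} = fcard phi {: stell}.
  by apply: eq_n_comp; apply: face_permE.
rewrite fcard_stell_sigma fcard_stell_phi card_prod card_prod card_bool.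
rewrite (_ : _ %/ 2 = 2 * #|C|); last by lia.
have one (T : finType) (e : rel T) (z0 : T) : connect_sym e ->
    (forall x y, connect e x y) -> n_comp e T = 1.
  move=> se ce; rewrite -(n_comp_connect se z0).
  by apply: eq_n_comp_r => y; rewrite inE [RHS]ce.
have n1 := one _ _ x0 (maprel_connect_sym a b) conn.
have n2 := one _ _ (bin x0) (maprel_connect_sym stell_alpha stell_sigma) stell_connected.
move: planar_ab; rewrite /planar_pair n1 n2; lia.
Qed.

Lemma stell_plane : plane_2conn_multigraph stell_alpha stell_sigma.
Proof.
split; [exact: stell_edge_inv | exact: stell_loopless | | exact: stell_genus0].
split; last 1 first.
- apply: del_rel_connected; [exact: stell_edge_inv | exact: stell_loopless
    | exact: stell_connected | exact: stell_face_simple].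
- rewrite fcard_stell_sigma.
  have a2 : 1 < fcard a C.
    apply/fcard_gt1P => //; first exact: perm_inj.
    by exists x0 => //; exists (b x0) => //; apply: stell_ab_neq.
  have : 0 < fcard (a * b)%g C.
    by apply/fcard_gt0P => //; [exact: perm_inj | exists x0].
  lia.
- exact: stell_connected.
Qed.

(** The face of [bin x] consists of the [bin y] with [y] in the [b]-orbit of [x]. By [ab_simple]
    these lie at distinct black vertices, so counting vertices of the face is counting elements of
    the orbit. *)
Lemma hypermap_odd_coloring k : pfo_bound_P k ->
  exists col : C -> 'I_k,
    (forall x, col (a x) = col x) /\
    forall x c, #|[set y | fconnect b x y & col y == c]| = 0 \/
                odd #|[set y | fconnect b x y & col y == c]|.
Proof.
move=> /(_ _ _ _ stell_plane)[col [colS _ colF]].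
have colE d d' : fconnect stell_sigma d d' -> col d = col d'.
  by apply: (fconnect_invariant (k := col)) => z; rewrite /= colS eqxx.
exists (col \o bin); split=> [x|x c] /=.
  by apply: colE; rewrite stell_sigma_black //= fconnect_perm_sym fconnect1.
have := colF (bin x) c; rewrite /face_color_count.
set A := [set _ | _ in _]; set B := [set y | _ & _].
suff -> : A = [set froot stell_sigma (bin y) | y in B].
  rewrite card_in_imset // => y z; rewrite !inE => /andP[xy _] /andP[xz _].
  move/(rootP (fconnect_perm_sym _)); rewrite stell_sigma_black //= => yz.
  by apply: ab_simple yz _; rewrite -(same_connect (fconnect_perm_sym b) xy).
apply/setP => d; apply/imsetP/imsetP => -[e].
  rewrite inE /= face_permE => /andP[xe ce] ->.
  have eE : e = bin e.1.
    have /stell_face_inv := xe; rewrite /stell_face /= => -[].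
    by case: (e) => y [[] []].
  by exists e.1; rewrite -?eE // inE -eE ce andbT -stell_phi_bin -eE.
rewrite inE => /andP[xe ce] ->; exists (bin e) => //.
by rewrite inE /= face_permE stell_phi_bin xe.
Qed.

End Stellation.

(** * Restricting a genus-0 pair to one component *)

Lemma connect_ind (T : finType) (e : rel T) (P : T -> Prop) x y :
  P x -> (forall u v, P u -> e u v -> P v) -> connect e x y -> P y.
Proof.
move=> Px step /connectP[p e_p ->].
by elim: p x Px e_p => //= z p IHp x Px /andP[/(step _ _ Px) Pz /(IHp z Pz)].
Qed.

Lemma n_comp_fixed (T : finType) (e : rel T) (A : pred T) : connect_sym e ->
  (forall x y, A x -> e x y -> y = x) -> n_comp e A = #|A|.
Proof.
move=> se fixA; apply: eq_card => x; rewrite !inE /=.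
apply: andb_idl => Ax; apply/eqP.
have /(connect_ind (P := fun y => y = x)) : connect e x (root e x) by rewrite connect_root.
by apply=> // u v -> /fixA; apply.
Qed.

Section Component.

Variables (D : finType) (a b : {perm D}) (x0 : D).

Let C := [pred x | connect (maprel a b) x0 x].
Let CT := {x | C x}.
Let Q := [set x | ~~ C x].

Fact inQ x : (x \in Q) = ~~ C x.
Proof. by rewrite inE. Qed.

Fact C_a x : C x -> C (a x).
Proof. by move/connect_trans; apply; apply: maprel1. Qed.

Fact C_b x : C x -> C (b x).
Proof. by move/connect_trans; apply; apply: maprel2. Qed.

Definition comp_fun_a (x : CT) : CT := Sub (a (val x)) (C_a (valP x)).
Definition comp_fun_b (x : CT) : CT := Sub (b (val x)) (C_b (valP x)).

Fact comp_fun_a_inj : injective comp_fun_a.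
Proof. by move=> x y /(congr1 val) /= /perm_inj /val_inj. Qed.

Fact comp_fun_b_inj : injective comp_fun_b.
Proof. by move=> x y /(congr1 val) /= /perm_inj /val_inj. Qed.

Definition comp_a : {perm CT} := perm comp_fun_a_inj.
Definition comp_b : {perm CT} := perm comp_fun_b_inj.

Lemma val_comp_a x : val (comp_a x) = a (val x).
Proof. by rewrite permE. Qed.

Lemma val_comp_b x : val (comp_b x) = b (val x).
Proof. by rewrite permE. Qed.

Definition comp_x0 : CT := Sub x0 (connect0 _ x0).

Lemma fconnect_val (s : {perm D}) (sC : {perm CT}) :
  (forall x, val (sC x) = s (val x)) ->
  forall x y, fconnect s (val x) (val y) = fconnect sC x y.
Proof.
move=> sE x y.
have it n : val (iter n sC x) = iter n s (val x) by elim: n => //= n <-; apply: sE.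
apply/idP/idP => /iter_findex; last by move=> <-; rewrite it fconnect_iter.
by rewrite -it => /val_inj <-; apply: fconnect_iter.
Qed.

Lemma comp_connected x y : connect (maprel comp_a comp_b) x y.
Proof.
suff H z : connect (maprel comp_a comp_b) comp_x0 z.
  by apply: connect_trans (H y); rewrite maprel_connect_sym.
have /(connect_ind (P := fun y => exists2 v : CT, val v = y &
    connect (maprel comp_a comp_b) comp_x0 v)) : connect (maprel a b) x0 (val z) := valP z.
case.
- by exists comp_x0 => //; apply: connect0.
- move=> u v [u' <- cu] /orP[] /eqP ->.
    by exists (comp_b u'); [rewrite val_comp_b | apply: connect_trans cu (maprel2 _ _ _)].
  by exists (comp_a u'); [rewrite val_comp_a | apply: connect_trans cu (maprel1 _ _ _)].
by move=> v /val_inj ->.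
Qed.

Lemma remove_closed (s : {perm D}) x : (forall x, C x -> C (s x)) ->
  remove Q s x = if C x then s x else x.
Proof.
move=> Cs; case: ifP => Cx; last by rewrite remove_fix // inQ Cx.
by rewrite remove_step // inQ negbK // Cs.
Qed.

Lemma fcard_remove_comp (s : {perm D}) (sC : {perm CT}) :
  (forall x, C (s x) = C x) -> (forall x, ~~ C x -> s x = x) ->
  (forall x, val (sC x) = s (val x)) -> fcard s D = fcard sC {: CT} + #|Q|.
Proof.
move=> Cs sQ sE; rewrite (n_compC C); congr (_ + _).
  apply: (n_comp_transfer (h := val) (k := insubd comp_x0)) => //.
  - by move=> x; apply: valP.
  - by move=> d Cd; rewrite insubdK.
  - exact: fconnect_val.
rewrite n_comp_fixed; last by move=> x y Cx /eqP <-; apply: sQ.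
  by apply: eq_card => x; rewrite inQ.
exact: fconnect_perm_sym.
Qed.

Hypothesis planar_ab : planar_pair a b.

(** All darts outside the component are turned into common fixed points. Each one adds 3 to the
    orbit counts on the left, and 1 dart and 1 component, hence 3, on the right, so they cancel. *)
Lemma comp_planar : planar_pair comp_a comp_b.
Proof.
have symM := maprel_connect_sym a b.
have Ca x : C (a x) = C x by apply: (same_connect_r symM); rewrite symM maprel1.
have Cb x : C (b x) = C x by apply: (same_connect_r symM); rewrite symM maprel2.
have aE x := @remove_closed a x C_a; have bE x := @remove_closed b x C_b.
have := planar_pair_remove Q (planar_pairC (planar_pair_remove Q planar_ab)).
move/planar_pairC; set a' := remove Q a; set b' := remove Q b.
rewrite /planar_pair (@fcard_remove_comp a' comp_a); first last.
- by move=> x; rewrite aE (valP x) val_comp_a.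
- by move=> x nx; rewrite aE (negPf nx).
- by move=> x; rewrite aE; case: ifP => Cx; rewrite ?Ca.
rewrite (@fcard_remove_comp b' comp_b); first last.
- by move=> x; rewrite bE (valP x) val_comp_b.
- by move=> x nx; rewrite bE (negPf nx).
- by move=> x; rewrite bE; case: ifP => Cx; rewrite ?Cb.
rewrite (@fcard_remove_comp (a' * b')%g (comp_a * comp_b)%g); first last.
- by move=> x; rewrite !permM aE bE (valP x) Ca (valP x) val_comp_b val_comp_a.
- by move=> x nx; rewrite permM bE aE (negPf nx) (negPf nx).
- by move=> x; rewrite permM bE aE; case: (boolP (C x)) => Cx;
    rewrite ?Ca ?Cx ?Cb ?Ca ?(negPf Cx).
have -> : n_comp (maprel a' b') D = 1 + #|Q|.
  rewrite (n_compC C); congr (_ + _).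
    rewrite -(n_comp_connect (maprel_connect_sym a' b') x0).
    apply: eq_n_comp_r => y; rewrite !inE; apply/idP/idP.
      pose P y := C y /\ connect (maprel a' b') x0 y.
      suff H : connect (maprel a b) x0 y -> P y by move/H => [].
      apply: connect_ind; first by split; apply: connect0.
      move=> u v [Cu cu] /orP[] /eqP ->; split; rewrite ?Ca ?Cb //.
        by have := maprel2 a' b' u; rewrite bE Cu; apply: connect_trans.
      by have := maprel1 a' b' u; rewrite aE Cu; apply: connect_trans.
    apply: (connect_ind (P := fun z => is_true (C z))) => [|u v Cu /orP[] /eqP ->]; first exact: connect0.
      by rewrite bE Cu Cb.
    by rewrite aE Cu Ca.
  rewrite n_comp_fixed; last first.
  - move=> x y nCx; have Cx : C x = false := negPf nCx.
    by move=> /orP[] /eqP ->; rewrite ?aE ?bE Cx.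
  - exact: maprel_connect_sym.
  by apply: eq_card => x; rewrite inQ.
have -> : n_comp (maprel comp_a comp_b) {: CT} = 1.
  rewrite -(n_comp_connect (maprel_connect_sym comp_a comp_b) comp_x0).
  by apply: eq_n_comp_r => y; rewrite inE [RHS]comp_connected.
have -> : #|D| = #|{: CT}| + #|Q|.
  rewrite card_sig -(cardC C); congr (_ + _); by apply: eq_card => x; rewrite inQ.
set A1 := n_comp _ _; set A2 := n_comp _ _; set A3 := n_comp _ _.
set q := #|Q|; set m := #|_|; lia.
Qed.

Hypothesis ab_simple : forall x y, fconnect a x y -> fconnect b x y -> x = y.
Hypothesis b_nofix : forall x, C x -> b x != x.

Lemma component_odd_coloring k : pfo_bound_P k ->
  exists col : D -> 'I_k, forall x, C x ->
    col (a x) = col x /\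
    forall c, #|[set y | fconnect b x y & col y == c]| = 0 \/
              odd #|[set y | fconnect b x y & col y == c]|.
Proof.
move=> bound.
have [||||col [col_a col_b]] :=
    @hypermap_odd_coloring _ comp_a comp_b comp_x0 _ _ _ _ k bound.
- exact: comp_connected.
- exact: comp_planar.
- by move=> x; rewrite -val_eqE val_comp_b b_nofix //; apply: valP.
- move=> x y; rewrite -!(fconnect_val val_comp_a) -(fconnect_val val_comp_b).
  by move=> xy /(ab_simple xy)/val_inj.
pose cl d := col (insubd comp_x0 d).
have clE z : cl (val z) = col z by rewrite /cl valKd.
exists cl => x Cx; pose x' : CT := Sub x Cx.
rewrite -[x]/(val x') -val_comp_a !clE; split=> [|c]; first exact: col_a.
have := col_b x' c; set B := [set y | _ & _]; set B' := [set y | _ & _].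
suff -> : B' = val @: B by rewrite card_imset //; apply: val_inj.
apply/setP => y; apply/idP/imsetP => [|[z]].
  rewrite inE => /andP[xy cy].
  have Cy : C y.
    by apply: (connect_trans Cx); apply: fconnect_maprel xy => z; apply: maprel2.
  exists (Sub y Cy); rewrite ?SubK // inE -(fconnect_val val_comp_b) /= xy.
  by rewrite -clE.
by rewrite !inE => /andP[xz cz] ->; rewrite (fconnect_val val_comp_b) xz clE.
Qed.

End Component.

(** As [E] is closed under [a] and [b], it is a union of components. Each is coloured on its own, as
    2-connectedness demands a connected map; outside [E] lie the fixed points left by removals. *)
Lemma planar_pair_odd_coloring (D : finType) (a b : {perm D}) (E : pred D) k :
  0 < k -> pfo_bound_P k -> planar_pair a b ->
  (forall x y, fconnect a x y -> fconnect b x y -> x = y) ->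
  (forall x, E x -> [/\ E (a x), E (b x) & b x != x]) ->
  exists col : D -> 'I_k, forall x, E x ->
    col (a x) = col x /\
    forall c, #|[set y | fconnect b x y & col y == c]| = 0 \/
              odd #|[set y | fconnect b x y & col y == c]|.
Proof.
move=> k0 bound planar_ab ab_simple Eab.
have Ecl x y : E x -> connect (maprel a b) x y -> E y.
  move=> Ex; apply: (connect_ind (P := fun z => is_true (E z))) => // u v Eu; have [Ea Eb _] := Eab u Eu.
  by move=> /orP[] /eqP ->.
have /fin_all_exists[f fP] : forall x0, exists col : D -> 'I_k, E x0 ->
    forall x, connect (maprel a b) x0 x -> col (a x) = col x /\
    forall c, #|[set y | fconnect b x y & col y == c]| = 0 \/
              odd #|[set y | fconnect b x y & col y == c]|.
  move=> x0; have [Ex0|nE] := boolP (E x0); last by exists (fun=> Ordinal k0).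
  have [|col colP] := component_odd_coloring (x0 := x0) planar_ab ab_simple _ bound.
    by move=> x /(Ecl _ _ Ex0)/Eab[].
  by exists col => _; apply: colP.
have symM := maprel_connect_sym a b.
exists (fun x => f (root (maprel a b) x) x) => x Ex.
have rE y : connect (maprel a b) x y -> root (maprel a b) y = root (maprel a b) x.
  by move=> xy; apply/esym/(rootP symM).
have [||fa fb] := fP (root (maprel a b) x) _ x.
- by apply: Ecl Ex _; apply: connect_root.
- by rewrite symM connect_root.
rewrite rE ?maprel1 //; split=> // c; have := fb c.
congr (_ = 0 \/ odd _); apply: eq_card => y; rewrite !inE;
  case: (boolP (fconnect b x y)) => //= xy;
  rewrite (rE y) //; by apply: fconnect_maprel xy => z; apply: maprel2.
Qed.

(** * Neighbourhoods in an independent set of a planar graph *)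

Lemma genus0_planar_pair (D : finType) (al sg : {perm D}) :
  edge_inv al -> genus0 al sg -> planar_pair al sg.
Proof.
move=> alK; rewrite /genus0 /planar_pair.
have -> : fcard (face_perm al sg) D = fcard (al * sg)%g D.
  by apply: eq_n_comp; apply: face_permE.
have <- : fcard al D * 2 = #|D|.
  apply: fcard_order_set => //; first exact: perm_inj.
  apply/subsetP => x _; rewrite inE; have [al2 al1] := alK x.
  rewrite -[2]/(size [:: x; al x]); apply/eqP.
  apply: order_cycle; rewrite ?inE ?eqxx //=; first by rewrite al2 !eqxx.
  by rewrite inE eq_sym al1.
set A1 := n_comp _ _; set A2 := n_comp _ _; set A3 := n_comp _ _; lia.
Qed.

Section GraphMap.

Variables (T : finType) (e : rel T) (alpha sigma : {perm dart e}).
Hypothesis e_simple : simple_graph e.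
Hypothesis gm : graph_map alpha sigma.

Definition src (d : dart e) := (val d).1.
Definition tgt (d : dart e) := (val d).2.

Lemma dartP d : e (src d) (tgt d).
Proof. exact: (valP d). Qed.

Lemma dart_inj d d' : src d = src d' -> tgt d = tgt d' -> d = d'.
Proof.
rewrite /src /tgt => s t; apply: val_inj; move: s t.
by case: (val d) (val d') => [? ?] [? ?] /= -> ->.
Qed.

Lemma dart_exists u v : e u v -> {d : dart e | src d = u & tgt d = v}.
Proof.
move=> uv.
by exists (Sub (u, v) (uv : (fun p => e p.1 p.2) (u, v))); rewrite /src /tgt SubK.
Qed.

Lemma src_alpha d : src (alpha d) = tgt d.
Proof. by case: gm => alE _ _; rewrite /src alE. Qed.

Lemma tgt_alpha d : tgt (alpha d) = src d.
Proof. by case: gm => alE _ _; rewrite /tgt alE. Qed.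

Lemma alphaK d : alpha (alpha d) = d.
Proof. by apply: dart_inj; rewrite !(src_alpha, tgt_alpha). Qed.

Lemma src_neq_tgt d : src d != tgt d.
Proof.
by apply/eqP => st; have := dartP d; rewrite st; case: e_simple => _ ->.
Qed.

Lemma alpha_edge_inv : edge_inv alpha.
Proof.
move=> d; rewrite alphaK; split=> //.
by apply: contraNneq (src_neq_tgt d) => {2}<-; rewrite tgt_alpha.
Qed.

Lemma fconnect_src d d' : fconnect sigma d d' = (src d == src d').
Proof.
case: gm => _ sgE conn; apply/idP/eqP; last exact: conn.
by apply: (fconnect_invariant (k := src)) => z; apply/eqP/sgE.
Qed.

(* Keep only the edges from [A] to vertices with at least two neighbours in [A],
   with [P] the darts leaving [A] and [P'] the opposite ones. As the kept graph is
   bipartite, removing [P'] from both the vertex and the face permutation leaves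
   on [P] a hypermap whose [a]-orbits are the vertices in [A] and whose [b]-orbits
   are the neighbourhoods to be coloured. *)
Lemma planar_neighbour_coloring (A : {pred T}) k :
  genus0 alpha sigma -> 0 < k -> pfo_bound_P k ->
  (forall u v, u \in A -> v \in A -> ~~ e u v) ->
  exists col : T -> 'I_k, forall w c,
    #|[set u in A | e w u & col u == c]| = 0 \/
    odd #|[set u in A | e w u & col u == c]|.
Proof.
move=> g0 k0 bound indep; have [esym eirr] := e_simple.
have planar := genus0_planar_pair alpha_edge_inv g0.
(* A vertex with a single neighbour in [A] would give a fixed point of [b], that is, a one-sided
   polygon. Such a neighbourhood is odd under every colouring. *)
pose P := [set d | (src d \in A) && (1 < #|[set u in A | e (tgt d) u]|)].
pose P' := [set d | alpha d \in P].
have PE d : (d \in P) = (src d \in A) && (1 < #|[set u in A | e (tgt d) u]|).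
  by rewrite inE.
have P'E d : (d \in P') = (alpha d \in P) by rewrite inE.
have PA d : d \in P -> src d \in A by rewrite PE => /andP[].
have P'A d : d \in P' -> tgt d \in A by rewrite P'E => /PA; rewrite src_alpha.
have disj d : d \in P -> d \in P' -> false.
  by move=> /PA sA /P'A tA; have := indep _ _ sA tA; rewrite dartP.
pose Q := ~: (P :|: P').
have QE d : (d \in Q) = ~~ ((d \in P) || (d \in P')) by rewrite !inE.
have alP d : (alpha d \in P) = (d \in P') by rewrite P'E.
have alP' d : (alpha d \in P') = (d \in P) by rewrite P'E alphaK.
pose s := remove Q sigma; pose t := remove Q alpha.
have sQ d : (s d \notin Q) = (d \notin Q).
  apply/idP/idP; last exact: remove_notin.
  by apply: contra => dQ; rewrite /s remove_fix.
have ssrc d : src (s d) = src d.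
  have [dQ|dQ] := boolP (d \in Q); first by rewrite /s remove_fix.
  by apply/eqP; rewrite -fconnect_src fconnect_perm_sym -(remove_fconnect _ dQ)
     ?sQ // fconnect1.
have sP d : d \in P -> s d \in P.
  move=> dP; have : s d \notin Q by rewrite sQ QE dP.
  rewrite QE negbK => /orP[//|/P'A tA].
  by have := indep _ _ (PA _ dP) tA; rewrite -ssrc dartP.
have sP' d : d \in P' -> s d \in P'.
  move=> dP; have : s d \notin Q by rewrite sQ QE dP orbT.
  rewrite QE negbK => /orP[/PA|//]; rewrite ssrc => sA.
  by have := indep _ _ sA (P'A _ dP); rewrite dartP.
have tE d : d \notin Q -> t d = alpha d.
  move=> dQ; apply: remove_step => //; move: dQ.
  by rewrite !QE !negbK alP alP' orbC.
have PQ d : d \in P -> d \notin Q by move=> dP; rewrite QE dP.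
have P'Q d : d \in P' -> d \notin Q by move=> dP; rewrite QE dP orbT.
have PP' d : d \in P -> d \notin P' by move=> dP; apply/negP => /(disj _ dP).
pose psi := (s * t)%g.
(* Removing [P'] from [t] would lose all information, since [t] exchanges [P] and [P']. The face
   permutation [psi] also alternates between them, but there the removal leaves its square on [P].
   Hence [b] becomes the rotation around the target, conjugated by [alpha]. *)
pose a0 := remove P' s^-1%g; pose p := remove P' psi.
pose a := a0^-1%g; pose b := (a0 * p)%g.
have planar_st : planar_pair s t.
  by apply/planar_pair_remove/planar_pairC/planar_pair_remove.
have planar_ab : planar_pair a b.
  apply: planar_pair_mul; apply: planar_pair_remove; apply: planar_pairC.
  by apply: planar_pair_remove; apply: planar_pairC; apply: planar_pair_mul.
have psiE d : d \in P -> psi d = alpha (s d).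
  by move=> dP; rewrite permM tE // PQ ?sP.
have psiE' d : d \in P' -> psi d = alpha (s d).
  by move=> dP; rewrite permM tE // P'Q ?sP'.
have sVP d : d \in P -> s^-1%g d \in P.
  move=> dP; have : s^-1%g d \notin Q by rewrite -sQ permKV PQ.
  rewrite QE negbK => /orP[//|/sP']; rewrite permKV => /(disj _ dP) //.
have a0E d : d \in P -> a0 d = s^-1%g d.
  by move=> dP; apply: remove_step; rewrite PP' ?sVP.
have aE d : d \in P -> a d = s d.
  by move=> dP; apply: (@perm_inj _ a0); rewrite permKV a0E ?permK // sP.
have pE d : d \in P -> p d = alpha (s (alpha (s d))).
  move=> dP; have sd := sP _ dP.
  have h : psi d \in P' by rewrite psiE // alP'.
  have h2 : psi (psi d) = alpha (s (alpha (s d))) by rewrite psiE' // psiE.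
  by rewrite /p remove_step2 ?h2 ?PP' // alP sP' // alP'.
have bE d : d \in P -> b d = alpha (s (alpha d)).
  by move=> dP; rewrite permM a0E // pE ?sVP // permKV.
have a0_fix d : d \notin P -> a0 d = d.
  move=> dP; have [dP'|dP'] := boolP (d \in P'); first exact: remove_fix.
  have dQ : d \in Q by rewrite QE (negPf dP).
  have sd : s^-1%g d = d by apply: (@perm_inj _ s); rewrite permKV /s remove_fix.
  by rewrite /a0 remove_step ?sd //.
have p_fix d : d \notin P -> p d = d.
  move=> dP; have [dP'|dP'] := boolP (d \in P'); first exact: remove_fix.
  have dQ : d \in Q by rewrite QE (negPf dP).
  have sd : psi d = d by rewrite permM /s /t !remove_fix.
  by rewrite /p remove_step ?sd //.
have a_fix d : d \notin P -> a d = d.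
  by move=> dP; apply: (@perm_inj _ a0); rewrite permKV a0_fix.
have b_fix d : d \notin P -> b d = d by move=> dP; rewrite permM a0_fix // p_fix.
have asrc d : src (a d) = src d.
  by have [dP|/a_fix ->] := boolP (d \in P); rewrite ?aE.
have btgt d : tgt (b d) = tgt d.
  have [dP|/b_fix -> //] := boolP (d \in P).
  by rewrite bE // tgt_alpha ssrc src_alpha.
have bP d : d \in P -> b d \in P by move=> dP; rewrite bE // alP sP' // alP'.
have a_src d d' : fconnect a d d' -> src d = src d'.
  by apply: (fconnect_invariant (k := src)) => z; rewrite /= asrc eqxx.
have b_tgt d d' : fconnect b d d' -> tgt d = tgt d'.
  by apply: (fconnect_invariant (k := tgt)) => z; rewrite /= btgt eqxx.
have itP n d : d \in P -> iter n b d \in P /\ iter n b d = alpha (iter n s (alpha d)).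
  move=> dP; elim: n => [|n [iP iE]] /=; first by rewrite alphaK.
  by split; [exact: bP | rewrite bE // iE alphaK].
have tgt_b d d' : d \in P -> d' \in P -> tgt d = tgt d' -> fconnect b d d'.
  move=> dP dP' tt; have : fconnect s (alpha d) (alpha d').
    by rewrite remove_fconnect ?P'Q ?alP' // fconnect_src !src_alpha tt.
  move/iter_findex => h; have [_] := itP (findex s (alpha d) (alpha d')) d dP.
  by rewrite h alphaK => <-; apply: fconnect_iter.
have ab_simple d d' : fconnect a d d' -> fconnect b d d' -> d = d'.
  by move=> /a_src ss /b_tgt; apply: dart_inj.
have dart_P u w : u \in A -> e w u -> 1 < #|[set u in A | e w u]| ->
    exists d, [/\ src d = u, tgt d = w & d \in P].
  move=> uA wu w2; rewrite esym in wu; have [d du dw] := dart_exists wu.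
  by exists d; split; rewrite // PE du uA dw.
have [|cl clP] := planar_pair_odd_coloring (E := mem P) k0 bound planar_ab ab_simple.
  move=> d dP; split; [by rewrite /= aE //; apply: sP | exact: bP |].
  have : 1 < #|[set u in A | e (tgt d) u]| by move: (dP); rewrite /= PE => /andP[].
  move=> w2; have /card_gt1P[u [v]] := w2; rewrite !inE => -[/andP[uA wu] /andP[vA wv] uv].
  have [d1 [d1s d1t d1P]] := dart_P _ _ uA wu w2.
  have [d2 [d2s d2t d2P]] := dart_P _ _ vA wv w2.
  apply: contraNneq uv => bdd.
  have only d' : fconnect b d d' -> d' = d.
    by apply: (connect_ind (P := fun z => z = d)) => // x y -> /eqP <-.
  have e1 := only _ (tgt_b _ _ dP d1P (Logic.eq_sym d1t)).
  have e2 := only _ (tgt_b _ _ dP d2P (Logic.eq_sym d2t)).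
  by rewrite -d1s -d2s e1 e2.
(* The choice of dart is immaterial, [cl] being constant on [a]-orbits. The default colour falls
   only on vertices that matter for no [w] with two neighbours in [A]. *)
pose col v := if [pick d | (d \in P) && (src d == v)] is Some d then cl d
              else Ordinal k0.
have colE d : d \in P -> col (src d) = cl d.
  move=> dP; rewrite /col; case: pickP => [d' /andP[dP' /eqP ss]|/(_ d)]; last by rewrite dP eqxx.
  have : fconnect s d' d by rewrite remove_fconnect ?PQ // fconnect_src ss.
  move/iter_findex <-; elim: (findex s d' d) => //= n IHn.
  have iP : iter n s d' \in P by elim: (n) => //= m; apply: sP.
  by have [cla _] := clP _ iP; rewrite -aE // cla.
exists col => w c; have [w2|w1] := ltnP 1 #|[set u in A | e w u]|; last first.
  have : #|[set u in A | e w u & col u == c]| <= 1.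
    apply: leq_trans w1; apply: subset_leq_card; apply/subsetP => u.
    by rewrite !inE => /and3P[-> ->].
  by case: #|_| => [|[|//]]; [left | right].
have /card_gt1P[u [u' [+ _ _]]] := w2; rewrite inE => /andP[uA wu].
have [d [ds dt dP]] := dart_P _ _ uA wu w2.
have [_ /(_ c)] := clP _ dP; set B := [set y | _ & _]; set B' := [set y in A | _].
have BP y : fconnect b d y -> y \in P.
  by move/iter_findex <-; case: (itP (findex b d y) d dP).
suff -> : B' = src @: B.
  rewrite card_in_imset // => y z; rewrite !inE => /andP[dy _] /andP[dz _] ss.
  by apply: dart_inj => //; rewrite -(b_tgt _ _ dy) (b_tgt _ _ dz).
apply/setP => v; apply/idP/imsetP => [|[y]].
  rewrite inE => /and3P[vA wv cv]; have [y [ys yt yP]] := dart_P _ _ vA wv w2.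
  exists y; rewrite // inE tgt_b ?dt ?yt //= -colE // ys; exact: cv.
rewrite inE => /andP[dy cy] ->; have yP := BP _ dy.
by rewrite inE PA // -dt (b_tgt _ _ dy) esym dartP colE.
Qed.

End GraphMap.

(** * The pentagon forces five colours *)

Section Pentagon.

(** The edge [i] joins the vertices [i] and [r^-1 i]. The boolean is its orientation, and also tells
    the two faces apart. *)
Definition pent := ('I_5 * bool)%type.

Definition pent_rot : {perm 'I_5} := perm (can_inj (@ordSK 5)).

Let r := pent_rot.

Definition pent_alpha_fun (d : pent) : pent := (d.1, ~~ d.2).

Definition pent_sigma_fun (d : pent) : pent :=
  if d.2 then (r d.1, false) else ((r^-1)%g d.1, true).

Lemma pent_alpha_funK : involutive pent_alpha_fun.
Proof. by case=> i b; rewrite /pent_alpha_fun negbK. Qed.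

Lemma pent_sigma_funK : involutive pent_sigma_fun.
Proof. by case=> i []; rewrite /pent_sigma_fun /= ?permK ?permKV. Qed.

Definition pent_alpha : {perm pent} := perm (inv_inj pent_alpha_funK).
Definition pent_sigma : {perm pent} := perm (inv_inj pent_sigma_funK).

Let phi := (pent_alpha * pent_sigma)%g.

Lemma pent_sigmaE d : pent_sigma d = pent_sigma_fun d.
Proof. exact: permE. Qed.

Lemma pent_alphaE d : pent_alpha d = pent_alpha_fun d.
Proof. exact: permE. Qed.

Lemma pent_phiE d : phi d = pent_sigma_fun (pent_alpha_fun d).
Proof. by rewrite permM pent_alphaE pent_sigmaE. Qed.

Lemma pent_rotE i : val (r i) = i.+1 %% 5.
Proof. by rewrite permE. Qed.

Lemma pent_rot1 i : r i != i.
Proof.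
by rewrite -val_eqE pent_rotE; case: i => [[|[|[|[|[|]]]]] //].
Qed.

Lemma pent_rot2 i : r (r i) != i.
Proof.
by rewrite -val_eqE !pent_rotE; case: i => [[|[|[|[|[|]]]]] //].
Qed.

Lemma pent_rot_connect i j : fconnect r i j.
Proof.
suff H l : fconnect r ord0 l.
  by apply: connect_trans (H j); rewrite fconnect_perm_sym.
have -> : l = iter l r ord0; last exact: fconnect_iter.
have it n : n < 5 -> val (iter n r ord0) = n.
  by elim: n => //= n IHn lt5; rewrite pent_rotE IHn 1?ltnW // modn_small.
by apply: val_inj; rewrite it.
Qed.

Definition pent_vertex (d : pent) : 'I_5 := if d.2 then d.1 else (r^-1)%g d.1.

Lemma pent_vertexP d d' : fconnect pent_sigma d d' = (pent_vertex d == pent_vertex d').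
Proof.
apply/idP/eqP.
  apply: (fconnect_invariant (k := pent_vertex)) => -[i []];
    by rewrite /= pent_sigmaE /pent_vertex /= ?permK eqxx.
have H d1 : fconnect pent_sigma d1 (pent_vertex d1, true).
  case: d1 => i []; first exact: connect0.
  by have := fconnect1 pent_sigma (i, false); rewrite pent_sigmaE.
move=> E; apply: connect_trans (H d) _; rewrite E fconnect_perm_sym; exact: H.
Qed.

Lemma pent_face_side d d' : fconnect phi d d' -> d.2 = d'.2.
Proof.
by apply: (fconnect_invariant (k := snd)) => -[i []]; rewrite /= pent_phiE.
Qed.

Lemma pent_phi_side i j b : fconnect phi (i, b) (j, b).
Proof.
have H n l : fconnect phi (l, false) (iter n r l, false).
  elim: n => [|n IHn]; first exact: connect0.
  apply: connect_trans IHn _.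
  by have := fconnect1 phi (iter n r l, false); rewrite pent_phiE.
have H' n l : fconnect phi (iter n r l, true) (l, true).
  elim: n => [|n IHn]; first exact: connect0.
  apply: connect_trans IHn.
  have := fconnect1 phi (iter n.+1 r l, true).
  by rewrite pent_phiE /= /pent_sigma_fun /= permK.
case: b.
  by rewrite -(iter_findex (pent_rot_connect j i)).
by rewrite -(iter_findex (pent_rot_connect i j)).
Qed.

Lemma pent_edge_inv : edge_inv pent_alpha.
Proof.
move=> d; rewrite !pent_alphaE pent_alpha_funK; split=> //.
by case: d => i []; rewrite /pent_alpha_fun -pair_eqE /= andbF.
Qed.

Lemma pent_rotV i : (r^-1)%g i != i.
Proof. by rewrite -{2}(permKV r i) eq_sym pent_rot1. Qed.

Lemma pent_loopless : loopless_map pent_alpha pent_sigma.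
Proof.
move=> [i []]; rewrite pent_alphaE pent_vertexP /pent_vertex /= ?pent_rotV //.
by rewrite eq_sym pent_rotV.
Qed.

Lemma pent_connected d d' : connect (maprel pent_alpha pent_sigma) d d'.
Proof.
have sub : subrel (fconnect phi) (connect (maprel pent_alpha pent_sigma)).
  apply: fconnect_maprel => z; rewrite permM.
  by apply: connect_trans (maprel1 _ _ _) (maprel2 _ _ _).
case: d d' => [i b] [j b'].
apply: (@connect_trans _ _ (j, b)); first exact/sub/pent_phi_side.
have [->|nb] := eqVneq b b'; first exact: connect0.
have := maprel1 pent_alpha pent_sigma (j, b); rewrite pent_alphaE.
by case: b b' nb => [] [].
Qed.

Lemma pent_face_simple d d' :
  fconnect (face_perm pent_alpha pent_sigma) d d' -> fconnect pent_sigma d d' ->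
  d = d'.
Proof.
rewrite face_permE pent_vertexP => /pent_face_side.
by case: d d' => [i []] [j []] //= _ /eqP; rewrite /pent_vertex /=;
  [move-> | move/perm_inj->].
Qed.

Lemma fcard_pent_sigma : fcard pent_sigma {: pent} = 5.
Proof.
have E : fcard (1%g : {perm 'I_5}) 'I_5 = 5.
  by rewrite -[RHS](card_ord 5) -[RHS]fcard_id; apply: eq_fcard => x; rewrite perm1.
rewrite -[RHS]E.
apply: (n_comp_transfer (h := fun i => (i, true)) (k := pent_vertex)) => //.
  by move=> d _; rewrite pent_vertexP.
move=> i j; rewrite pent_vertexP /pent_vertex /=.
apply/eqP/idP => [->|]; first exact: connect0.
by move/iter_findex <-; elim: (findex _ i j) => //= n <-; rewrite perm1.
Qed.

Lemma fcard_pent_rot : fcard r 'I_5 = 1.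
Proof.
apply: etrans (n_comp_connect (fconnect_perm_sym r) ord0).
by apply: eq_n_comp_r => i; rewrite inE [RHS]pent_rot_connect.
Qed.

Lemma fcard_pent_phi : fcard phi {: pent} = 2.
Proof.
rewrite (n_compC [pred d : pent | d.2]).
apply: (etrans (y := fcard r 'I_5 + fcard r 'I_5)); last by rewrite fcard_pent_rot.
by congr (_ + _);
  [apply: (n_comp_transfer (h := fun i => (i, true)) (k := fst))
  | apply: (n_comp_transfer (h := fun i => (i, false)) (k := fst))] => //;
  try (by move=> [i []]; rewrite /= pent_phiE);
  try (by move=> [i []] //= _; apply: connect0);
  try (by move=> i j; rewrite pent_phi_side pent_rot_connect).
Qed.

Lemma pent_genus0 : genus0 pent_alpha pent_sigma.
Proof.
rewrite /genus0.
have -> : fcard (face_perm pent_alpha pent_sigma) {: pent} = fcard phi {: pent}.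
  by apply: eq_n_comp; apply: face_permE.
rewrite fcard_pent_sigma fcard_pent_phi card_prod card_ord card_bool.
have -> // : n_comp (maprel pent_alpha pent_sigma) {: pent} = 1.
apply: etrans (n_comp_connect (maprel_connect_sym pent_alpha pent_sigma) (ord0, true)).
by apply: eq_n_comp_r => d; rewrite inE [RHS]pent_connected.
Qed.

Lemma pent_outerplane : outerplane_2conn_graph pent_alpha pent_sigma.
Proof.
split.
- split; [exact: pent_edge_inv | exact: pent_loopless | | exact: pent_genus0].
  split; [by rewrite fcard_pent_sigma | exact: pent_connected |].
  apply: del_rel_connected; [exact: pent_edge_inv | exact: pent_loopless
    | exact: pent_connected | exact: pent_face_simple].
- move=> [i b] [j b']; rewrite !pent_vertexP !pent_alphaE /pent_vertex /=.
  have rV l : (r^-1)%g ((r^-1)%g l) != l.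
    by rewrite -{2}(permKV r l) -{2}(permKV r ((r^-1)%g l)) eq_sym pent_rot2.
  case: b b' => [] [] /=.
  + by move=> /eqP ->.
  + by move=> /eqP -> /eqP h; have := rV j; rewrite h eqxx.
  + by move=> /eqP <- /eqP h; have := rV i; rewrite -h eqxx.
  + by move=> /eqP /perm_inj ->.
- exists (ord0, true) => y; exists (pent_vertex y, true).
  by rewrite face_permE pent_phi_side pent_vertexP.
Qed.

(** A colour class is disjoint from its rotation, hence has at most two of the five vertices. A face
    contains all five, so parity leaves only classes of size one. *)
Lemma pfo_bound_Po_ge5 k : pfo_bound_Po k -> 4 < k.
Proof.
move=> /(_ _ _ _ pent_outerplane)[col [colS colA colF]].
pose c i := col (i, true).
have cr i : c (r i) != c i.
  have := colA (r i, true); rewrite pent_alphaE.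
  by rewrite -(colS (pent_alpha_fun _)) pent_sigmaE /pent_sigma_fun /= permK.
have cS x : #|[set i | c i == x]| = 0 \/ odd #|[set i | c i == x]|.
  have := colF (ord0, true) x; rewrite /face_color_count.
  set A := [set _ | _ in _]; set B := [set i | _].
  suff -> : A = [set froot pent_sigma (i, true) | i in B].
    rewrite card_imset // => i j /(rootP (fconnect_perm_sym _)).
    by rewrite pent_vertexP => /eqP.
  apply/setP => d; apply/imsetP/imsetP => -[y].
    rewrite inE /= face_permE => /andP[fy cy] ->; have := pent_face_side fy.
    by case: y fy cy => i [] // _ cy _; exists i; rewrite // inE.
  rewrite inE => cy ->; exists (y, true) => //.
  by rewrite inE /= face_permE pent_phi_side.
suff cinj : injective c by have := leq_card c cinj; rewrite !card_ord.
move=> i j cij; apply/eqP; apply: contraT => nij.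
have two : 1 < #|[set l | c l == c i]|.
  by apply/card_gt1P; exists i, j; rewrite !inE cij eqxx.
have := cS (c i); set S := [set l | _] in two *.
have dis : [disjoint S & r @: S].
  rewrite disjoint_sym; apply/pred0P => l /=; apply/negbTE/negP => /andP[/imsetP[m]].
  by rewrite !inE => /eqP cm ->; rewrite -cm (negPf (cr m)).
have := subset_leq_card (subsetT (S :|: r @: S)).
rewrite cardsU disjoint_setI0 // cards0 cardsT card_ord card_imset; last exact: perm_inj.
by case: #|S| two => [|[|[|n]]] //; lia.
Qed.

End Pentagon.

(** * Odd colourings of noncrossing families of integers *)

Definition zero_or_odd n := (n == 0) || odd n.

Section OddWord.

Variable k : nat.
Hypothesis k5 : 4 < k.

Lemma fresh_color (s : seq 'I_k) : size s < 5 -> exists z, z \notin s.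
Proof.
move=> s5; apply/existsP; rewrite -negb_forall; apply/negP => /forallP all_s.
have : #|'I_k| <= size s.
  apply: leq_trans (card_size s); apply: subset_leq_card.
  by apply/subsetP => z _; apply: all_s.
by rewrite card_ord; lia.
Qed.

(* The word is [x y x y ...] followed by at most three letters used once and a
   final [y], with [x] and [y] occurring an odd number of times each. *)
Lemma odd_word (x y : 'I_k) n : x != y ->
  exists w : seq 'I_k, [/\ size w = n.+1, path (fun c d => c != d) x w,
    last x w = y & forall z, zero_or_odd (count_mem z (x :: w))].
Proof.
move=> nxy.
have [z1] := fresh_color (s := [:: x; y]) isT.
rewrite !inE negb_or => /andP[n1x n1y].
have [z2] := fresh_color (s := [:: x; y; z1]) isT.
rewrite !inE !negb_or => /and3P[n2x n2y n21].
have [z3] := fresh_color (s := [:: x; y; z1; z2]) isT.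
rewrite !inE !negb_or => /and4P[n3x n3y n31 n32].
have uniq_odd s : uniq s -> forall z, zero_or_odd (count_mem z s).
  by move=> us z; rewrite count_uniq_mem //; case: (z \in s).
have nyx : y != x by rewrite eq_sym.
have nx1 : x != z1 by rewrite eq_sym.
have nx2 : x != z2 by rewrite eq_sym.
have nx3 : x != z3 by rewrite eq_sym.
have n12 : z1 != z2 by rewrite eq_sym.
have n13 : z1 != z3 by rewrite eq_sym.
have n23 : z2 != z3 by rewrite eq_sym.
have neq := (nxy, nyx, nx1, nx2, nx3, n12, n13, n23, n1y, n2y, n3y).
(* Up to five letters may all be distinct; beyond that, four letters [y x y x] are inserted after
   the initial [x]. *)
elim/ltn_ind: n => -[|[|[|[|n]]]] IHn.
- exists [:: y]; split; rewrite ?[path _ _ _]/= ?neq //.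
  by apply: uniq_odd; rewrite /= !inE ?negb_or ?neq.
- exists [:: z1; y]; split; rewrite ?[path _ _ _]/= ?neq //.
  by apply: uniq_odd; rewrite /= !inE ?negb_or ?neq.
- exists [:: z1; z2; y]; split; rewrite ?[path _ _ _]/= ?neq //.
  by apply: uniq_odd; rewrite /= !inE ?negb_or ?neq.
- exists [:: z1; z2; z3; y]; split; rewrite ?[path _ _ _]/= ?neq //.
  by apply: uniq_odd; rewrite /= !inE ?negb_or ?neq.
have [|w [sw pw lw cw]] := IHn n; first by rewrite !ltnS leqW ?leqW.
exists [:: y, x, y, x & w]; split; rewrite /= ?sw ?nxy ?nyx //.
move=> z; have := cw z; rewrite /zero_or_odd /= => {neq n1x n1y nx1 n2x n2y n21}
  {nx2 n3x n3y n31 n32 nx3 n12 n13 n23 uniq_odd IHn}.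
have [<-|nxz] := eqVneq x z; first by rewrite [y == x]eq_sym (negPf nxy) /=; lia.
have [yz|nyz] := eqVneq y z; last by rewrite /=; lia.
(* Adding two keeps an odd count odd but would turn 0 into 2; [y] does occur, as the last letter. *)
have : 0 < count_mem z w.
  rewrite -has_count has_pred1 -yz; have := mem_last x w.
  by rewrite lw inE [y == x]eq_sym (negPf nxy).
by rewrite /=; lia.
Qed.

End OddWord.

Section Noncrossing.

Variable k : nat.
Hypothesis k5 : 4 < k.

Variables (J : finType) (L : J -> seq nat).
Hypothesis L_sorted : forall i, sorted ltn (L i).
Hypothesis noncrossing : forall i j m1 m2 m3 m4,
  m1 \in L i -> m2 \in L j -> m3 \in L i -> m4 \in L j ->
  m1 < m2 -> m2 < m3 -> m3 < m4 -> i = j.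

Definition within (i : J) p q := all (fun m => p <= m <= q) (L i).

Definition odd_on (c : nat -> 'I_k) (i : J) :=
  forall z, zero_or_odd (count_mem z (map c (L i))).

Definition gaps p (s : seq nat) := zip (p :: s) s.

Lemma L_uniq i : uniq (L i).
Proof. exact: sorted_uniq ltn_trans ltnn _ (L_sorted i). Qed.

Lemma odd_on_eq c c' i : {in L i, c =1 c'} -> odd_on c i -> odd_on c' i.
Proof. by move=> /eq_in_map E; rewrite /odd_on E. Qed.

Lemma odd_on_inj c i : {in L i &, injective c} -> odd_on c i.
Proof.
move=> ci z; rewrite count_uniq_mem; first by case: (z \in _).
by rewrite map_inj_in_uniq ?L_uniq.
Qed.

Lemma odd_on_pair (c : nat -> 'I_k) i p q : c p != c q ->
  {in L i, forall m, m = p \/ m = q} -> odd_on c i.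
Proof.
move=> cpq H; apply: odd_on_inj => m n /H mpq /H npq cmn.
by case: mpq npq cmn cpq => -> [] -> // ->; rewrite eqxx.
Qed.

Lemma gaps_bounds p s a b : path ltn p s -> (a, b) \in gaps p s ->
  [/\ p <= a, a < b, b <= last p s & 1 < size s -> b - a < last p s - p].
Proof.
elim: s p => //= q s IHs p /andP[pq qs]; rewrite inE => /predU1P[[-> ->]|ab].
  have ql : q <= last q s /\ (0 < size s -> q < last q s).
    case: s qs {IHs} => //= r s /andP[qr /(order_path_min ltn_trans)/allP h].
    have := mem_last r s; rewrite inE => /predU1P[->|/h /=]; lia.
  by split=> //; lia.
have [h1 h2 h3 h4] := IHs q qs ab; split=> //; lia.
Qed.

Lemma within_gap_ge i p s : path ltn p s ->
  has (fun ab => within i ab.1 ab.2) (gaps p s) -> {in L i, forall m, p <= m}.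
Proof.
move=> ps /hasP[[a b] ab /allP w] m /w /=.
have [] := gaps_bounds ps ab; lia.
Qed.

Lemma gap_or_span i p s : path ltn p s -> 0 < size s ->
  within i p (last p s) ->
  has (fun ab => within i ab.1 ab.2) (gaps p s) \/
  exists t m1 m2, [/\ t \in s, m1 \in L i, m2 \in L i, m1 < t & t < m2].
Proof.
elim: s p => //= q s IHs p /andP[pq qs] _ w.
have [small|] := boolP (within i p q); first by left.
case/allPn => m2 m2L; have := allP w _ m2L => /andP[pm2 m2l].
rewrite pm2 -ltnNge /= => qm2.
have [large|] := boolP (within i q (last q s)).
  have s0 : 0 < size s by case: (s) m2l => //=; lia.
  have [h|[t [m1 [m3 [ts]]]]] := IHs q qs s0 large.
    by left; exact: h.
  by right; exists t, m1, m3; rewrite inE ts orbT.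
case/allPn => m1 m1L; have := allP w _ m1L => /andP[pm1 m1l].
rewrite m1l andbT -ltnNge => m1q.
by right; exists q, m1, m2; rewrite inE eqxx.
Qed.

(** The colourings of neighbouring gaps agree at their common end, whose colour is a letter of the
    word. Adjacent letters have to differ because gaps are only coloured with distinct end
    colours. *)
Lemma glue_gaps p s x w :
  (forall a b y z, (a, b) \in gaps p s -> y != z -> exists c : nat -> 'I_k,
     [/\ c a = y, c b = z & forall i, within i a b -> odd_on c i]) ->
  path ltn p s -> size w = size s -> path (fun y z => y != z) x w ->
  exists c, map c (p :: s) = x :: w /\
    forall i, has (fun ab => within i ab.1 ab.2) (gaps p s) -> odd_on c i.
Proof.
elim: s p x w => [|q s IHs] p x [|y w] //= H.
  by move=> _ _ _; exists (fun=> x).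
move=> /andP[pq qs] [sw] /andP[nxy pw].
have [c1 [c1p c1q c1P]] := H p q x y (mem_head _ _) nxy.
have [|c2 [[c2q c2s] c2P]] := IHs q y w _ qs sw pw.
  by move=> a b u v ab; apply: H; rewrite inE ab orbT.
exists (fun m => if m <= q then c1 m else c2 m).
have agree m : q <= m -> (if m <= q then c1 m else c2 m) = c2 m.
  by move=> qm; case: ifP => // mq; have -> : m = q by [lia]; rewrite c1q c2q.
split.
  rewrite (ltnW pq) leqnn c1p c1q; congr [:: _, _ & _]; rewrite -c2s.
  apply/eq_in_map => m ms; apply: agree.
  by have /allP/(_ m ms)/ltnW := order_path_min ltn_trans qs.
move=> i /orP[w1|w2].
  apply: odd_on_eq (c1P i w1) => m /(allP w1) /andP[_ mq].
  by rewrite mq.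
apply: odd_on_eq (c2P i w2) => m mL.
by rewrite agree // (within_gap_ge qs w2).
Qed.

(** The end colours must differ since the pair of ends may itself be a set of the family. The
    interval is cut at suitable points so that, by noncrossing, a set not inside one gap contains
    both ends and is easy to control. *)
Lemma interval_coloring n : forall p q x y, p < q -> q - p <= n -> x != y ->
  exists c : nat -> 'I_k,
    [/\ c p = x, c q = y & forall i, within i p q -> odd_on c i].
Proof.
elim: n => [|n IHn] p q x y pq pqn nxy; first by lia.
case: (boolP [exists i, [&& within i p q, p \in L i, q \in L i & 2 < size (L i)]]).
  case/existsP => i0 /and4P[w0 p0 q0 s0].
  have [s Ls] : exists s, L i0 = p :: s.
    move: w0 p0; rewrite /within; case: (L i0) (L_sorted i0) => //= m s ms /andP[/andP[pm _] _].
    rewrite inE => /predU1P[<-|ps]; first by exists s.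
    by have /allP/(_ p ps) := order_path_min ltn_trans ms; rewrite /=; lia.
  have ps : path ltn p s by have := L_sorted i0; rewrite Ls.
  have lq : last p s = q.
    have := mem_last p s; rewrite -Ls => /(allP w0) /andP[_ lq].
    apply/eqP; rewrite eqn_leq lq /=.
    move: q0; rewrite Ls inE => /predU1P[qp|]; first by lia.
    have : sorted leq s by apply: sub_sorted (path_sorted ps) => ? ? /ltnW.
    case: (s) => //= r s' rs.
    rewrite inE => /predU1P[->|].
      case: (s') rs => //= r' s'' rs.
      have /allP := order_path_min leq_trans (rs : path leq r (r' :: s'')); apply.
      exact: mem_last.
    move=> qs'; case/splitPr: qs' rs => s1 s2; rewrite cat_path last_cat /= => /and3P[_ _ qs2].
    have := mem_last q s2; rewrite inE => /predU1P[->//|].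
    by have /allP := order_path_min leq_trans qs2; apply.
  have ss : 1 < size s by move: s0; rewrite Ls.
  (* The points of [i0] receive an odd word. Having a point strictly between [p] and [q], it cuts
     the interval into shorter gaps, which the induction hypothesis colours. *)
  have [w [sw pw lw cw]] := odd_word k5 (size s).-1 nxy.
  rewrite prednK ?(ltnW ss) // in sw.
  have [|c [cs cP]] := glue_gaps _ ps sw pw.
    move=> a b u v ab nuv; have [h1 h2 _ h4] := gaps_bounds ps ab.
    by apply: IHn => //; have := h4 ss; rewrite lq; lia.
  have cp : c p = x by case: cs.
  have cq : c q = y by rewrite -lq -[RHS]lw -(last_map c) cp; case: cs => _ ->.
  exists c; split=> // i wi.
  have [->|ni] := eqVneq i i0; first by rewrite /odd_on Ls cs.
  have [|gi|[t [m1 [m2 [ts m1L m2L m1t tm2]]]]] := gap_or_span ps (ltnW ss) (i := i).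
  - by rewrite lq.
  - exact: cP gi.
  have t0 : t \in L i0 by rewrite Ls inE ts orbT.
  have /andP[pm1 m1q] := allP wi _ m1L; have /andP[pm2 m2q] := allP wi _ m2L.
  have m1p : m1 = p.
    apply/eqP; rewrite eqn_leq pm1 andbT leqNgt; apply: contra ni => pm.
    by apply/eqP/esym; apply: noncrossing p0 m1L t0 m2L _ _ _.
  have m2q' : m2 = q.
    apply/eqP; rewrite eqn_leq m2q /= leqNgt; apply: contra ni => pm.
    by apply/eqP; apply: noncrossing m1L t0 m2L q0 _ _ _.
  subst m1 m2.
  (* Any interior point of [i] equals any interior point of [i0]. So [i] either has no interior
     point, or consists of the same three points as [i0]. *)
  have same m u : m \in L i -> u \in L i0 -> p < m < q -> p < u < q -> m = u.
    move=> mL uL /andP[pm mq] /andP[pu uq].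
    case: (ltngtP m u) => // mu; case/eqP: ni.
      by apply/esym; apply: noncrossing p0 mL uL m2L _ _ _.
    by apply: noncrossing m1L uL mL q0 _ _ _.
  have tpq : p < t < q by rewrite m1t.
  have [/hasP[m mL mpq]|/hasPn none] := boolP (has (fun m => p < m < q) (L i)).
    have mt := same _ _ mL t0 mpq tpq.
    suff LL : L i = L i0 by rewrite /odd_on LL Ls cs.
    apply: (irr_sorted_eq ltn_trans ltnn (L_sorted i) (L_sorted i0)) => u.
    apply/idP/idP => uL.
      have /andP[pu uq] := allP wi _ uL.
      have [->//|up] := eqVneq u p; have [->//|uq'] := eqVneq u q.
      by rewrite (same u t) // !ltn_neqAle eq_sym up pu uq'.
    have /andP[pu uq] := allP w0 _ uL.
    have [->//|up] := eqVneq u p; have [->//|uq'] := eqVneq u q.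
    by rewrite -(same m u) // !ltn_neqAle eq_sym up pu uq'.
  apply: (odd_on_pair (p := p) (q := q)) => [|m mL]; first by rewrite cp cq.
  have := none _ mL; have /andP[] := allP wi _ mL; clear; lia.
rewrite negb_exists => /forallP small.
have pair c i : c p = x -> c q = y -> within i p q -> p \in L i -> q \in L i ->
    odd_on c i.
  move=> cp cq wi pL qL; apply: (odd_on_pair (p := p) (q := q)); first by rewrite cp cq.
  have := small i; rewrite wi pL qL /= -leqNgt => s2 m mL.
  have [||_ E] := @uniq_min_size _ [:: p; q] (L i) _ _ s2.
  - by rewrite /= inE (ltn_eqF pq).
  - by move=> u; rewrite !inE => /orP[] /eqP ->.
  by move: mL; rewrite -E !inE => /orP[] /eqP; [left | right].
have [qp|qp] := eqVneq q p.+1.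
  pose c m := if m == p then x else y.
  have cp : c p = x by rewrite /c eqxx.
  have cq : c q = y by rewrite /c qp; case: eqP => //; lia.
  exists c; split=> // i wi.
  apply: (odd_on_pair (p := p) (q := q)) => [|m mL]; first by rewrite cp cq.
  by have /andP[] := allP wi _ mL; lia.
pose partner r := [exists i, [&& within i p q, p \in L i & r \in L i]].
(* The cut point is the farthest companion of [p] short of [q]. A set with points on both sides of
   [r] must contain [p] by noncrossing, then [q] by maximality, and so is the pair of ends. Without
   a companion, [p.+1] does the same. *)
have [r [pr rq rmax rwit]] : exists r, [/\ p < r, r < q,
    (forall r', partner r' -> r' < q -> r' <= r) & partner r \/ r = p.+1].
  pose B r := (p < r < q) && partner r.
  have [/hasP[r0 _ Br0]|/hasPn none] := boolP (has B (iota 0 q)).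
    have ub r : B r -> r <= q by case/andP => /andP[_ /ltnW].
    case: (ex_maxnP (ex_intro B r0 Br0) ub) => r /andP[/andP[pr rq] wr] rmax.
    exists r; split=> //; last by left.
    move=> r' wr' r'q; have [r'p|pr'] := leqP r' p; first by lia.
    by apply: rmax; rewrite /B pr' r'q.
  exists p.+1; split=> //; [lia | | by right].
  move=> r' wr' r'q; rewrite leqNgt; apply/negP => pr'.
  have := none r'; rewrite mem_iota r'q /B wr' r'q => /(_ isT); lia.
have [z] := fresh_color k5 (s := [:: x; y]) isT.
rewrite !inE negb_or => /andP[nzx nzy].
have prq : path ltn p [:: r; q] by rewrite /= pr rq.
have [||c [[cp cr cq] cP]] := @glue_gaps p [:: r; q] x [:: z; y] _ prq erefl.
- move=> a b u v; rewrite !inE => /orP[] /eqP[-> ->] nuv; apply: IHn => //; lia.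
- by rewrite /= eq_sym nzx nzy.
exists c; split=> // i wi.
have [//|gi|[t [m1 [m2 [trq m1L m2L m1t tm2]]]]] := gap_or_span prq isT (i := i).
- exact: cP gi.
have /andP[pm1 m1q] := allP wi _ m1L; have /andP[pm2 m2q] := allP wi _ m2L.
have tr : t = r by move: trq; rewrite !inE => /orP[] /eqP //; lia.
subst t.
have pL : p \in L i.
  have [<-//|m1p] := eqVneq m1 p.
  case: rwit => [/existsP[j /and3P[wj pj rj]]|rp]; last first.
    by move: m1t pm1 m1p; rewrite rp; clear; lia.
  by rewrite -(noncrossing pj m1L rj m2L) // ltn_neqAle eq_sym m1p.
apply: pair => //; have [<-//|m2q'] := eqVneq m2 q.
have : partner m2 by apply/existsP; exists i; rewrite wi pL.
by move/rmax => H; have := H (_ : m2 < q); rewrite ltn_neqAle m2q' m2q leqNgt tm2 => /(_ isT).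
Qed.

Lemma noncrossing_coloring : exists c : nat -> 'I_k, forall i, odd_on c i.
Proof.
(* The interval up to [N.+1] contains all the sets, and has distinct ends even if they are all
   empty. *)
pose N := \max_(i : J) \max_(m <- L i) m.
pose x := Ordinal (ltn_trans (isT : 0 < 4) k5).
pose y := Ordinal (ltn_trans (isT : 1 < 4) k5).
have [//||//|c [_ _ cP]] := @interval_coloring N.+1 0 N.+1 x y.
  by rewrite subn0.
exists c => i; apply: cP; apply/allP => m mL; rewrite leq0n ltnW // ltnS.
by apply: leq_trans (leq_bigmax i); apply: leq_bigmax_seq.
Qed.

End Noncrossing.

(** * Neighbourhoods do not cross along a face *)

Lemma planar_pair_isolate (D : finType) (s t : {perm D}) x :
  planar_pair s t -> planar_pair (isolate s x) t.
Proof.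
move=> pst; have := isolate_euler s t x; have := euler_bound (isolate s x) t.
move: pst; rewrite /planar_pair.
set a := n_comp _ _; set b := n_comp _ _; set c := n_comp _ _.
set d := n_comp _ _; set g := n_comp _ _; set f := n_comp _ _; set h := n_comp _ _.
lia.
Qed.

Lemma fconnect_tperm_sub (D : finType) (s : {perm D}) x y :
  ~~ fconnect s x y -> subrel (fconnect s) (fconnect (tperm x y * s)%g).
Proof.
move=> nxy; have xy := fconnect_tperm_merge nxy.
have step z : fconnect (tperm x y * s)%g z (s (tperm x y z)).
  by have := fconnect1 (tperm x y * s)%g z; rewrite permM.
apply: connect_sub => z _ /eqP <-.
case: (tpermP x y z) (step z) => [->|->|_ _ //] _.
  by apply: connect_trans xy _; have := step y; rewrite tpermR.
rewrite fconnect_perm_sym in xy.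
by apply: connect_trans xy _; have := step x; rewrite tpermL.
Qed.

Lemma mul_tperm (D : finType) (s : {perm D}) x y :
  (s * tperm x y = tperm (s^-1 x) (s^-1 y) * s)%g.
Proof. by rewrite -tpermJ conjgE invgK -!mulgA mulVg mulg1. Qed.

Section Crossing.

Variables (T : finType) (e : rel T) (alpha sigma : {perm dart e}).
Hypothesis e_simple : simple_graph e.
Hypothesis gm : graph_map alpha sigma.
Hypothesis g0 : genus0 alpha sigma.

Let phi := (alpha * sigma)%g.

Let srcA := src_alpha gm.
Let tgtA := tgt_alpha gm.
Let alK := alphaK gm.

Lemma src_sigma d : src (sigma d) = src d.
Proof. by case: gm => _ sgE _; apply: sgE. Qed.

Lemma src_phi d : src (phi d) = tgt d.
Proof. by rewrite permM src_sigma srcA. Qed.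

Lemma tgt_phiV d : tgt ((phi^-1)%g d) = src d.
Proof. by rewrite -src_phi permKV. Qed.

Lemma fconnect_phi_alpha d d' : tgt d = tgt d' -> fconnect (phi * alpha)%g d d'.
Proof.
move=> tt; have : fconnect sigma (alpha d) (alpha d').
  by rewrite (fconnect_src gm) !srcA tt.
move/iter_findex; set n := findex _ _ _ => h.
suff <- : iter n (phi * alpha)%g d = d' by apply: fconnect_iter.
rewrite -[RHS]alK -h; elim: n {h} => [|n IHn] /=; first by rewrite alK.
by rewrite IHn !permM alK.
Qed.

(* Contract the path [a - w - c] (removing its two edges from [alpha] while
   keeping the faces), then cut the outer face and the contracted vertex between
   [a] and [c]. Both orbits split, so by Euler's inequality the map falls apart;
   but [b - w' - d] still connects the two halves of the outer face. *)
Lemma no_crossing f0 n1 n2 n3 n4 w w' :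
  n1 < n2 -> n2 < n3 -> n3 < n4 -> n4 < fingraph.order phi f0 ->
  let vtx n := tgt (iter n phi f0) in
  uniq [:: vtx n1; vtx n2; vtx n3; vtx n4] ->
  w \notin [:: vtx n1; vtx n2; vtx n3; vtx n4] ->
  w' \notin [:: vtx n1; vtx n2; vtx n3; vtx n4] ->
  e w (vtx n1) -> e w (vtx n3) -> e w' (vtx n2) -> e w' (vtx n4) -> w = w'.
Proof.
move=> n12 n23 n34 n4o vtx; have [esym eirr] := e_simple.
set a := vtx n1; set b := vtx n2; set c := vtx n3; set d := vtx n4.
rewrite /= !inE !negb_or => /and4P[/and3P[nab nac nad] /andP[nbc nbd] ncd _].
move=> /and4P[nwa nwb nwc nwd] /and4P[nwa' nwb' nwc' nwd'] ewa ewc ewb' ewd'.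
apply/eqP/negPn/negP => nww'.
set y1 := iter n1 phi f0; set y2 := iter n2 phi f0.
set y3 := iter n3 phi f0; set y4 := iter n4 phi f0.
rewrite esym in ewa; rewrite esym in ewc.
have [d1 d1s d1t] := dart_exists ewa; have [d2 d2s d2t] := dart_exists ewc.
have nd (x x' : dart e) : src x != src x' -> x != x' by apply: contraNneq => ->.
have n21 : d2 != d1 by apply: nd; rewrite d1s d2s eq_sym.
have n21' : d2 != alpha d1 by apply: nd; rewrite srcA d2s d1t eq_sym.
have n2'1 : alpha d2 != d1 by rewrite -(inj_eq (@perm_inj _ alpha)) alK.
have n2'1' : alpha d2 != alpha d1 by rewrite (inj_eq perm_inj).
have alphaV x : (alpha^-1)%g x = alpha x by apply: (@perm_inj _ alpha); rewrite permKV alK.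
pose u1 := isolate alpha d1; pose u2 := isolate u1 d2.
have u1E : u1 = (tperm d1 (alpha d1) * alpha)%g by rewrite /u1 /isolate alphaV.
have u1_other x : x != d1 -> x != alpha d1 -> u1 x = alpha x.
  by move=> x1 x2; rewrite u1E permM tpermD // eq_sym.
have u2E : u2 = (tperm d2 (alpha d2) * u1)%g.
  rewrite /u2 /isolate; congr (tperm _ _ * _)%g.
  by apply: (@perm_inj _ u1); rewrite permKV u1_other // alK.
have planar_u : planar_pair phi u2.
  apply/planar_pairC/planar_pair_isolate/planar_pair_isolate.
  have := planar_pair_mul (genus0_planar_pair (alpha_edge_inv e_simple gm) g0).
  by have -> // : (alpha^-1)%g = alpha by apply/permP.
(* The orbits of [v0] are the vertices, each as the darts pointing to it. Removing an edge from
   [alpha] multiplies by a transposition that merges its two ends: first [a] with [w], then [c] with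
   them. *)
pose v0 := (phi * alpha)%g.
pose x1 := (phi^-1)%g d1; pose x2 := (phi^-1)%g (alpha d1).
pose x3 := (phi^-1)%g d2; pose x4 := (phi^-1)%g (alpha d2).
pose v1 := (tperm x1 x2 * v0)%g.
have v1E : (phi * u1)%g = v1 by rewrite u1E mulgA mul_tperm -mulgA.
have vE : (phi * u2)%g = (tperm x3 x4 * v1)%g.
  by rewrite u2E mulgA mul_tperm -mulgA v1E.
have x1t : tgt x1 = a by rewrite tgt_phiV.
have x2t : tgt x2 = w by rewrite tgt_phiV srcA.
have x3t : tgt x3 = c by rewrite tgt_phiV.
have x4t : tgt x4 = w by rewrite tgt_phiV srcA.
have v0t x : tgt (v0 x) = tgt x by rewrite permM tgtA src_phi.
have v0_tgt x x' : fconnect v0 x x' -> tgt x = tgt x'.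
  by apply: (fconnect_invariant (k := @tgt T e)) => z; rewrite /= v0t eqxx.
have n12v : ~~ fconnect v0 x1 x2.
  by apply: contra nwa => /v0_tgt; rewrite x1t x2t => ->.
(* Identifying [w] with [a] gives an invariant of [v1], which shows that [c] is still separate
   before the second merge. *)
pose key (x : dart e) := if tgt x == w then a else tgt x.
have awF : (a == w) = false by rewrite eq_sym (negPf nwa).
have v1_key x x' : fconnect v1 x x' -> key x = key x'.
  apply: (fconnect_invariant (k := key)) => z; rewrite /= /key /v1 permM v0t.
  by case: tpermP => [->|->|_ _]; rewrite ?x1t ?x2t ?eqxx ?awF ?eqxx.
have n34v : ~~ fconnect v1 x3 x4.
  apply: contra nac => /v1_key; rewrite /key x3t x4t eqxx.
  by rewrite eq_sym (negPf nwc) => ->.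
have sub01 := fconnect_tperm_sub n12v; have sub12 := fconnect_tperm_sub n34v.
have merged : fconnect (phi * u2)%g y1 y3.
  rewrite vE.
  apply: (connect_trans (sub12 _ _ (sub01 _ _ (fconnect_phi_alpha (_ : tgt y1 = tgt x1))))) => //.
  apply: (connect_trans (sub12 _ _ (fconnect_tperm_merge n12v))).
  apply: (connect_trans (sub12 _ _ (sub01 _ _ (fconnect_phi_alpha (_ : tgt x2 = tgt x4))))).
    by rewrite x2t x4t.
  rewrite fconnect_perm_sym.
  apply: connect_trans (fconnect_tperm_merge n34v).
  by apply: sub12; apply: sub01; apply: fconnect_phi_alpha.
have inj_iter m n : m < fingraph.order phi f0 -> n < fingraph.order phi f0 ->
    iter m phi f0 = iter n phi f0 -> m = n.
  by move=> mo no E; rewrite -(findex_iter mo) E findex_iter.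
have n3o := ltn_trans n34 n4o; have n2o := ltn_trans n23 n3o.
have n1o := ltn_trans n12 n2o; have n13 := ltn_trans n12 n23.
have ny13 : y1 != y3 by apply/eqP => /(inj_iter _ _ n1o n3o) E; rewrite E ltnn in n13.
have y13 : fconnect phi y1 y3.
  by rewrite -(same_connect (fconnect_perm_sym phi) (fconnect_iter phi n1 f0)) fconnect_iter.
pose s := (tperm y1 y3 * phi)%g.
suff conn : connect (maprel s u2) y1 y3.
  have := n_comp_tperm_connected conn; have := euler_bound s u2.
  rewrite (fcard_tperm_split ny13 y13) -mulgA (fcard_tperm_split ny13 merged).
  move: planar_u; rewrite /planar_pair.
  set A1 := n_comp _ _; set A2 := n_comp _ _; set A3 := n_comp _ _.
  set A4 := n_comp _ _; set A5 := n_comp _ _; clear; lia.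
have symM := maprel_connect_sym s u2.
have s_other x : x != y1 -> x != y3 -> s x = phi x.
  by move=> x13 x33; rewrite permM tpermD // eq_sym.
have iter_other m : m < fingraph.order phi f0 -> m != n1 -> m != n3 ->
    s (iter m phi f0) = iter m.+1 phi f0.
  move=> mo mn1 mn3; rewrite s_other //.
    by apply: contraNneq mn1 => /(inj_iter _ _ mo n1o) ->.
  by apply: contraNneq mn3 => /(inj_iter _ _ mo n3o) ->.
have walk x lo hi : s x = iter lo.+1 phi f0 -> lo < hi ->
    hi < fingraph.order phi f0 -> (forall m, lo < m < hi -> m != n1 /\ m != n3) ->
    connect (maprel s u2) x (iter hi phi f0).
  move=> sx; elim: hi => // hi IHhi lohi ho avoid.
  have [hlo|hlo] := eqVneq lo hi; first by rewrite -hlo -sx maprel1.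
  have ltlo : lo < hi by rewrite ltn_neqAle hlo -ltnS.
  have [m1 m3] : hi != n1 /\ hi != n3 by apply: avoid; rewrite ltlo /=.
  apply: connect_trans (IHhi ltlo (ltnW ho) _) _.
    by move=> m /andP[lm mh]; apply: avoid; rewrite lm ltnW.
  by rewrite -iter_other ?maprel1 // ltnW.
(* The cut sends [y3] to the old successor of [y1] and [y1] to that of [y3]. The outer face thus
   splits into an arc through [y2] and an arc through [y4]. *)
have y32 : connect (maprel s u2) y3 y2.
  apply: (walk _ n1) => //; first by rewrite permM tpermR.
  by move=> m /andP[lm mh]; rewrite gtn_eqF // ltn_eqF // (ltn_trans mh).
have y14 : connect (maprel s u2) y1 y4.
  apply: (walk _ n3) => //; first by rewrite permM tpermL.
  by move=> m /andP[lm mh]; rewrite gtn_eqF ?(ltn_trans n13) // gtn_eqF.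
pose good t := [&& t != a, t != c & t != w].
have u2_other x : good (src x) \/ good (tgt x) -> u2 x = alpha x.
  move=> gx.
  have ne x' : src x' = a \/ src x' = c -> tgt x' = w -> x != x' /\ x != alpha x'.
    move=> sx' tx'; split; apply/eqP => xE; move: gx; rewrite xE ?srcA ?tgtA tx' /good eqxx !andbF.
      by case: sx' => ->; rewrite eqxx ?andbF; case.
    by case: sx' => ->; rewrite eqxx ?andbF; case.
  have [e1 e1'] := ne d1 (or_introl d1s) d1t.
  have [e2 e2'] := ne d2 (or_intror d2s) d2t.
  by rewrite u2E permM tpermD 1?eq_sym // u1_other.
(* Around a vertex other than [a], [c], [w], neither the contraction nor the cut changes anything,
   so the rotation there is still available. *)
have turn x x' : tgt x = tgt x' -> good (tgt x) -> connect (maprel s u2) x x'.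
  move=> tt gx; have := fconnect_phi_alpha tt; move/iter_findex <-.
  elim: (findex _ x x') => [|n IHn] /=; first exact: connect0.
  apply: connect_trans IHn _; set z := iter n _ x.
  have zt : tgt z = tgt x by rewrite /z; elim: (n) => //= m <-; apply: v0t.
  have sz : s z = phi z.
    by apply: s_other; apply: contraTneq gx => zE; rewrite -zt zE /good eqxx ?andbF.
  have -> : (phi * alpha)%g z = u2 (s z).
    by rewrite sz permM u2_other // src_phi zt; left.
  by apply: connect_trans (maprel1 _ _ _) (maprel2 _ _ _).
have gb : good b by rewrite /good eq_sym nab nbc eq_sym nwb.
have gd : good d by rewrite /good ![d == _]eq_sym nad ncd nwd.
have gw' : good w' by rewrite /good nwa' nwc' eq_sym nww'.
have [h1 h1s h1t] := dart_exists ewb'; have [h2 h2s h2t] := dart_exists ewd'.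
rewrite symM; apply: (connect_trans y32).
apply: connect_trans (_ : connect _ y4 y1); last by rewrite symM.
apply: (connect_trans (turn _ h1 _ _)); rewrite ?h1t //.
apply: (connect_trans (maprel2 s u2 h1)); rewrite u2_other; last by rewrite h1t; right.
apply: (connect_trans (turn _ (alpha h2) _ _)); rewrite ?tgtA ?h1s ?h2s //.
apply: (connect_trans (maprel2 s u2 _)); rewrite u2_other; last by rewrite tgtA h2s; right.
by rewrite alK turn // h2t.
Qed.

End Crossing.

(** * Neighbourhoods in an independent set of an outerplanar graph *)

Section Outerplanar.

Variables (T : finType) (e : rel T) (alpha sigma : {perm dart e}).
Hypothesis e_simple : simple_graph e.
Hypothesis gm : graph_map alpha sigma.
Hypothesis g0 : genus0 alpha sigma.

Let phi := (alpha * sigma)%g.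

Variables (A : {pred T}) (k : nat).
Hypothesis k5 : 4 < k.
Hypothesis indep : forall u v, u \in A -> v \in A -> ~~ e u v.

Definition odd_at (col : T -> 'I_k) (w : T) := forall c,
  #|[set u in A | e w u & col u == c]| = 0 \/
  odd #|[set u in A | e w u & col u == c]|.

Lemma face_neighbour_coloring f0 : exists col : T -> 'I_k, forall w,
  (forall u, u \in A -> e w u -> exists2 z, fconnect phi f0 z & tgt z = u) ->
  odd_at col w.
Proof.
pose n := fingraph.order phi f0.
pose vtx m := tgt (iter m phi f0); pose vs := [seq vtx m | m <- iota 0 n].
(* A cut vertex is met several times by the face walk; the [index] condition keeps its first visit
   only. *)
pose L w := [seq m <- iota 0 n | [&& index (vtx m) vs == m, vtx m \in A & e w (vtx m)]].
have memL w m : (m \in L w) =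
    [&& m < n, index (vtx m) vs == m, vtx m \in A & e w (vtx m)].
  by rewrite mem_filter mem_iota andbC.
have vtx_inj w w' m m' : m \in L w -> m' \in L w' -> vtx m = vtx m' -> m = m'.
  rewrite !memL => /and4P[_ /eqP mE _ _] /and4P[_ /eqP mE' _ _] E.
  by rewrite -mE -mE' E.
have [|i j m1 m2 m3 m4 m1L m2L m3L m4L m12 m23 m34|c cP] :=
    @noncrossing_coloring k k5 T L.
- by move=> w; apply: sorted_filter; [apply: ltn_trans | apply: iota_ltn_sorted].
- have n13 := ltn_trans m12 m23; have n24 := ltn_trans m23 m34.
  have n14 := ltn_trans m12 n24.
  have ne w w' m m' : m \in L w -> m' \in L w' -> m < m' -> vtx m != vtx m'.
    by move=> mL mL' mm'; apply: contraTneq mm' => /(vtx_inj _ _ _ _ mL mL') ->; rewrite ltnn.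
  have vA w m : m \in L w -> vtx m \in A by rewrite memL => /and4P[].
  have ve w m : m \in L w -> e w (vtx m) by rewrite memL => /and4P[].
  have notin w m : m \in L w -> w \notin [:: vtx m1; vtx m2; vtx m3; vtx m4].
    move=> mL; have wA : w \notin A.
      by apply/negP => wA; have := indep wA (vA _ _ mL); rewrite ve.
    apply: contra wA; rewrite !inE => /or4P[] /eqP ->;
      [exact: vA m1L | exact: vA m2L | exact: vA m3L | exact: vA m4L].
  apply: (no_crossing e_simple gm g0 (f0 := f0) m12 m23 m34).
  + by move: m4L; rewrite memL => /andP[].
  + rewrite /= !inE !negb_or (ne _ _ _ _ m1L m2L) // (ne _ _ _ _ m1L m3L) //.
    rewrite (ne _ _ _ _ m1L m4L) // (ne _ _ _ _ m2L m3L) //.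
    by rewrite (ne _ _ _ _ m2L m4L) // (ne _ _ _ _ m3L m4L).
  + exact: notin m1L.
  + exact: notin m2L.
  + exact: ve m1L.
  + exact: ve m3L.
  + exact: ve m2L.
  + exact: ve m4L.
exists (fun u => c (index u vs)) => w on_face x.
have := cP w x; rewrite /zero_or_odd count_map -size_filter.
set F := filter _ _.
have FL m : m \in F -> m \in L w by rewrite mem_filter => /andP[].
have -> : #|[set u in A | e w u & c (index u vs) == x]| = size F.
  rewrite -(size_map vtx); have <- : #|map vtx F| = size (map vtx F).
    apply/card_uniqP; rewrite map_inj_in_uniq ?filter_uniq ?iota_uniq //.
    by move=> m m' /FL mL /FL mL'; apply: vtx_inj mL mL'.
  apply: eq_card => u; rewrite inE; apply/and3P/mapP.
    move=> [uA wu cu]; have [z fz zu] := on_face u uA wu.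
    have u_vs : u \in vs.
      apply/mapP; exists (findex phi f0 z); first by rewrite mem_iota findex_max.
      by rewrite /vtx iter_findex.
    have ltu : index u vs < n by rewrite -[X in _ < X](size_iota 0) -(size_map vtx) index_mem.
    have vu : vtx (index u vs) = u.
      rewrite -[RHS](nth_index u u_vs) (nth_map 0) ?size_iota //.
      by rewrite nth_iota.
    exists (index u vs); last by [].
    by rewrite mem_filter /= cu memL ltu vu eqxx uA wu.
  case=> m; rewrite mem_filter /= memL => /and5P[cm _ /eqP mE mA wm] ->.
  by rewrite mE cm; split.
by case/orP => [/eqP|]; [left | right].
Qed.

Lemma outerplanar_neighbour_coloring :
  (forall x, exists f0, connect (maprel alpha sigma) x f0 /\
     forall y, connect (maprel alpha sigma) x y -> exists z,
       fconnect (face_perm alpha sigma) f0 z /\ (val z).1 = (val y).1) ->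
  exists col : T -> 'I_k, forall w, odd_at col w.
Proof.
move=> outer; have [esym _] := e_simple.
have symM := maprel_connect_sym alpha sigma.
have conn_src d d' : src d = src d' -> connect (maprel alpha sigma) d d'.
  move=> dd'; have : fconnect sigma d d' by rewrite (fconnect_src gm) dd'.
  by apply: fconnect_maprel => z; apply: maprel2.
have conn_nbr d u : e (src d) u ->
    exists2 d', src d' = u & connect (maprel alpha sigma) d d'.
  move=> du; have [d1 d1s d1t] := dart_exists du.
  exists (alpha d1); first by rewrite (src_alpha gm).
  by apply: connect_trans (conn_src _ d1 _) (maprel1 _ _ _).
have /fin_all_exists[F FP] : forall x, exists col : T -> 'I_k, forall d,
    connect (maprel alpha sigma) x d -> odd_at col (src d).
  move=> x; have [f0 [_ f0P]] := outer x.
  have [col colP] := face_neighbour_coloring f0; exists col => d xd.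
  apply: colP => u uA du; have [d' d'u dd'] := conn_nbr _ _ du.
  have [z [fz zu]] := f0P d' (connect_trans xd dd').
  (* Outerplanarity names the vertices of the face by sources of darts, [face_neighbour_coloring] by
     targets; one step back along the face converts. *)
  exists ((phi^-1)%g z); last by rewrite (tgt_phiV gm) -d'u.
  rewrite face_permE in fz; apply: (connect_trans fz).
  by rewrite fconnect_perm_sym -{2}(permKV phi z) fconnect1.
pose R := root (maprel alpha sigma).
(* The default colour goes to isolated vertices, which lie in no neighbourhood. *)
pose col v := if [pick d | src d == v] is Some d then F (R d) v
              else Ordinal (ltn_trans (isT : 0 < 4) k5).
have colE d : col (src d) = F (R d) (src d).
  rewrite /col; case: pickP => [d' /eqP dd'|/(_ d)]; last by rewrite eqxx.
  by congr (F _ _); apply/(rootP symM)/conn_src.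
exists col => w c; have [d /eqP <-|no_dart] := pickP (fun d : dart e => src d == w).
  have := FP (R d) d; rewrite symM connect_root => /(_ isT c).
  congr (_ = 0 \/ odd _); apply: eq_card => u; rewrite !inE;
    case: (boolP (e (src d) u)) => [du|]; rewrite ?andbF //;
    have [d' <- dd'] := conn_nbr _ _ du; rewrite colE;
    by rewrite /R (rootP symM dd').
left; apply: eq_card0 => u; rewrite !inE; apply/negP => /and3P[_ wu _].
by have [d ds _] := dart_exists wu; have := no_dart d; rewrite ds eqxx.
Qed.

End Outerplanar.

(** * From neighbourhood colourings to the product bound *)

(** The default [#|T|] of the minimum is also realised, by giving all vertices different colours. *)
Lemma proper_col_chi (T : finType) (e : rel T) : simple_graph e ->
  exists f : {ffun T -> 'I_(chi e)}, proper_col e f.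
Proof.
move=> [_ eirr]; apply/existsP; rewrite /chi.
apply: (big_ind (fun m => [exists f : {ffun T -> 'I_m}, proper_col e f])).
- apply/existsP; exists (finfun (@enum_rank T)).
  apply/forallP => x; apply/forallP => y; apply/implyP => exy; rewrite !ffunE.
  by apply: contraTneq exy => /enum_rank_inj ->; rewrite eirr.
- by move=> m1 m2 H1 H2; rewrite /minn; case: ifP.
- by [].
Qed.

Lemma bigminn_le (I : eqType) (r : seq I) (P : pred I) (F : I -> nat) n i :
  i \in r -> P i -> \big[minn/n]_(j <- r | P j) F j <= F i.
Proof.
elim: r => //= j r IHr; rewrite inE big_cons => /predU1P[<- -> |ir Pi].
  exact: geq_minl.
by case: ifP => _; [apply: leq_trans (geq_minr _ _) (IHr ir Pi) | apply: IHr].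
Qed.

(** A [k] above [#|T|] is outside the range of the minimum, but then the default already bounds the
    value. *)
Lemma chi_so_le (T : finType) (e : rel T) k (f : {ffun T -> 'I_k}) :
  strong_odd_col e f -> chi_so e <= k.
Proof.
move=> fP; rewrite /chi_so; have [kT|Tk] := ltnP k #|T|.+1.
  apply: (@bigminn_le _ _ _ _ _ (Ordinal kT)); first exact: mem_index_enum.
  by apply/existsP; exists f.
apply: leq_trans (ltnW Tk).
apply: (big_ind (fun m => m <= #|T|)) => [//|m1 m2 H1 _|[m lt_m] _] /=.
  exact: leq_trans (geq_minl _ _) H1.
by rewrite -ltnS.
Qed.

Lemma chi_so_le_mul (T : finType) (e : rel T) k : simple_graph e ->
  (forall A : {pred T}, (forall u v, u \in A -> v \in A -> ~~ e u v) ->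
     exists col : T -> 'I_k, forall w c,
       #|[set u in A | e w u & col u == c]| = 0 \/
       odd #|[set u in A | e w u & col u == c]|) ->
  chi_so e <= k * chi e.
Proof.
move=> se H; have [f fP] := proper_col_chi se.
have fe x y : e x y -> f x != f y.
  by move/forallP/(_ x)/forallP/(_ y)/implyP: fP.
have /fin_all_exists[cl clP] : forall i, exists col : T -> 'I_k, forall w c,
    #|[set u in [pred u | f u == i] | e w u & col u == c]| = 0 \/
    odd #|[set u in [pred u | f u == i] | e w u & col u == c]|.
  move=> i; apply: H => u v; rewrite !inE => /eqP fu /eqP fv.
  by apply/negP => /fe; rewrite fu fv eqxx.
have cardE : #|{: 'I_k * 'I_(chi e)}| = k * chi e by rewrite card_prod !card_ord.
pose g x : 'I_(k * chi e) := cast_ord cardE (enum_rank (cl (f x) x, f x)).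
apply: (@chi_so_le _ _ _ (finfun g)).
have gE x c j : (finfun g x == cast_ord cardE (enum_rank (c, j))) =
    (f x == j) && (cl j x == c).
  rewrite ffunE (inj_eq (@cast_ord_inj _ _ _)) (inj_eq enum_rank_inj) -pair_eqE /=.
  by rewrite andbC; case: eqP => // ->.
have c_split (c : 'I_(k * chi e)) : exists i j, c = cast_ord cardE (enum_rank (i, j)).
  case E : (enum_val (cast_ord (Logic.eq_sym cardE) c)) => [i j]; exists i, j.
  by rewrite -E enum_valK cast_ordKV.
apply/andP; split.
  apply/forallP => x; apply/forallP => y; apply/implyP => exy.
  have [i [j gx]] := c_split (finfun g y); rewrite gx gE.
  have := gE y i j; rewrite -gx eqxx => /esym/andP[/eqP fy _].
  by rewrite -fy (negPf (fe _ _ exy)).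
apply/forallP => v; apply/implyP => _; apply/forallP => c.
have [i [j ->]] := c_split c.
have -> : [set u | e v u & finfun g u == cast_ord cardE (enum_rank (i, j))] =
          [set u in [pred u | f u == j] | e v u & cl j u == i].
  by apply/setP => u; rewrite !inE gE; case: (e v u); rewrite ?andbF //= andbT.
by case: (clP j v i) => [->|->]; rewrite ?orbT.
Qed.

Theorem theorem3p4 :
  (forall k : nat, pfo_bound_P k ->
     forall (T : finType) (e : rel T), simple_graph e -> planar e ->
       chi_so e <= k * chi e)
  /\
  (forall k : nat, pfo_bound_Po k ->
     forall (T : finType) (e : rel T), simple_graph e -> outerplanar e ->
       chi_so e <= k * chi e).
Proof.
split=> k bound T e se.
  (* A default colour is required, hence a positive [k]. A bound for plane multigraphs applies to
     outerplane graphs, so the pentagon supplies it. *)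
  have k5 : 4 < k.
    by apply: pfo_bound_Po_ge5 => D al sg [mP _ _]; apply: bound.
  move=> [al [sg [gm g0]]]; apply: chi_so_le_mul => // A indep.
  by apply: (planar_neighbour_coloring se gm g0 _ bound indep); apply: leq_trans k5.
move=> [al [sg [gm g0 outer]]]; apply: chi_so_le_mul => // A indep.
exact: (outerplanar_neighbour_coloring se gm g0 (pfo_bound_Po_ge5 bound) indep outer).
Qed.
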